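(* Let $G_1$ be a finite connected oriented graph with distinguished vertices $a_1,b_1$ such that $d_1(a_1,b_1)>1$ and there exist at least two edge-disjoint paths connecting $a_1$ to $b_1$ in $G_1$. Let $p_\star$ be the unique fixed point of $f_1$ in $(0,1)$ and $\zeta=f_1'(p_\star)$. Then there exists a non-decreasing homeomorphism $g:[0,+\infty]\to[0,1]$ such that, whenever $\varepsilon_k\in[0,1]$ is a sequence with $\lim_{k}\zeta^k\varepsilon_k=c\in[0,+\infty]$, $$\lim_{k\to\infty}\mathbb E_k\big[\mathbf 1_{C_k}(\omega_{p_\star})\,\mathbf 1_{C_k}(\omega_{p_\star}^{\varepsilon_k})\big]=p_\star^2\,g(c)+p_\star\,(1-g(c)).$$
   Context: $G_1=(V_1,\mathcal E_1)$ is a finite connected oriented graph (a finite simple graph with an orientation chosen for each edge), with two distinguished vertices $a_1,b_1$. Orientations are used only to define the replacement operation below; distances, paths and connectivity ignore orientation. $d_1$ is the graph distance in $G_1$. Hierarchical graphs: $G_0$ is a single oriented edge $(a_0,b_0)$. Given $G_k=(V_k,\mathcal E_k)$ with distinguished vertices $a_k,b_k$, the graph $G_{k+1}$ is obtained by replacing each oriented edge $(x,y)\in\mathcal E_k$ by a fresh copy of $G_1$, with $a_1$ identified with $x$ and $b_1$ with $y$; $a_{k+1},b_{k+1}$ are the vertices that were $a_k,b_k$. A configuration is an element of $\{0,1\}^{\mathcal E_k}$ ($1$ = open, $0$ = closed); $C_k$ is the event that $a_k$ and $b_k$ are joined by an open path in $G_k$. $f_1(p)$ is the probability of $C_1$ when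 edges of $G_1$ are independently open with probability $p$. Under the stated hypothesis on $G_1$, $f_1$ has exactly one fixed point $p_\star$ in $(0,1)$ and $f_1'(p_\star)>1$. Noise: let $(U_e,\tilde U_e,U'_e)_{e\in\mathcal E_k}$ be i.i.d. uniform on $[0,1]$ under $\mathbb P_k$ (expectation $\mathbb E_k$). Set $\omega_p(e)=\mathbf 1_{U_e\le p}$, and $\omega_p^{\varepsilon}(e)=\mathbf 1_{\tilde U_e\le p}$ if $U'_e\le\varepsilon$, $\omega_p^\varepsilon(e)=\omega_p(e)$ otherwise. *)

(* Defs.v *)
From HB Require Import structures.
From mathcomp Require Import all_boot all_order all_algebra.
Set Implicit Arguments.
Unset Strict Implicit.
Unset Printing Implicit Defensive.

(* Finite oriented graphs with two distinguished vertices.  The oriented edge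
   set is a finite type, [e] being the pair [(src e, tgt e)]; that distinct
   edges give distinct pairs is part of [simple_graph] below. *)
Record ograph := OGraph {
  vert : finType;
  edge : finType;
  src : edge -> vert;
  tgt : edge -> vert;
  vtxa : vert;
  vtxb : vert }.

Section Graph.
Variable G : ograph.
Implicit Types (e : edge G) (x y : vert G).

Definition joins e x y : bool :=
  ((src e == x) && (tgt e == y)) || ((src e == y) && (tgt e == x)).

Definition adj x y : bool := [exists e, joins e x y].

Definition simple_graph : Prop :=
  (forall e, src e != tgt e) /\
  (forall e e', joins e' (src e) (tgt e) -> e = e').

Definition connected_graph : Prop := forall x y, connect adj x y.

(* Least length of a walk from x to y; a shortest walk has fewer than
   #|vert G| edges, and the value is the junk #|vert G| when no walk exists. *)
Definition gdist x y : nat :=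
  find (fun n => [exists p : n.-tuple (vert G), path adj x p && (last x p == y)])
       (iota 0 #|vert G|).

(* The path visits x and then the vertices of s in order. *)
Definition simple_path x (s : seq (vert G)) y : bool :=
  [&& path adj x s, last x s == y & uniq (x :: s)].

(* In a simple graph, consecutive vertices determine the edge used. *)
Definition path_edges x (s : seq (vert G)) : {set edge G} :=
  [set e : edge G | has (fun u => joins e u.1 u.2) (zip (x :: s) s)].

Definition two_edge_disjoint_paths x y : Prop :=
  exists s t : seq (vert G),
    [/\ simple_path x s y, simple_path x t y &
        [disjoint path_edges x s & path_edges x t]].

Definition config : Type := {ffun edge G -> bool}.

Definition open_adj (w : config) x y : bool := [exists e, w e && joins e x y].

Definition crossing (w : config) : bool :=
  connect (open_adj w) (vtxa G) (vtxb G).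

(* Probability of [crossing] when edges are independently open with
   probability p. *)
Definition crossing_prob (R : nzRingType) (p : R) : R :=
  (\sum_(w : {ffun edge G -> bool} | crossing w)
     \prod_(e : edge G) (if w e then p else 1 - p))%R.

End Graph.

Definition single_edge : ograph :=
  @OGraph bool unit (fun=> false) (fun=> true) false true.

Section Replace.
Variables G H : ograph.

Definition inner : finType :=
  {v : vert H | (v != vtxa H) && (v != vtxb H)}.

(* Image of the vertex v of H in the copy of H that replaces the edge e of G. *)
Definition glue (e : edge G) (v : vert H) : vert G + edge G * inner :=
  if insub v is Some i then inr (e, i)
  else inl (if v == vtxa H then src e else tgt e).

Definition replace : ograph :=
  @OGraph (vert G + edge G * inner)%type (edge G * edge H)%type
    (fun u => glue u.1 (src u.2)) (fun u => glue u.1 (tgt u.2))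
    (inl (vtxa G)) (inl (vtxb G)).

End Replace.

(* [hgraph G1 1] is a copy of [G1], with the same edges up to [unit * _]. *)
Fixpoint hgraph (G1 : ograph) (k : nat) : ograph :=
  if k is k'.+1 then replace (hgraph G1 k') G1 else single_edge.

(* Imported only here because it overrides the finite set notations. *)
From mathcomp Require Import all_classical all_reals all_analysis.
Import Order.TTheory GRing.Theory Num.Theory.
Import numFieldNormedType.Exports.

Local Open Scope classical_set_scope.
Local Open Scope ring_scope.

Section Noise.
Context d (T : measurableType d) (R : realType) (P : probability T R).

Definition mutually_independent (I : finType) (X : I -> {RV P >-> R}) : Prop :=
  forall (J : {set I}) (B : I -> set R), (forall i, measurable (B i)) ->
    P [set t | forall i, i \in J -> B i (X i t)] =
    (\prod_(i in J) fine (P (X i @^-1` B i)))%:E.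

Definition uniform01 (X : {RV P >-> R}) : Prop :=
  forall A : set R, measurable A ->
    distribution P X A = uniform_prob (@ltr01 R) A.

Definition iid_uniform (I : finType) (X : I -> {RV P >-> R}) : Prop :=
  mutually_independent X /\ forall i, uniform01 (X i).

Variable G : ograph.
Variables U Ut U' : edge G -> {RV P >-> R}.

(* The three families as one, since independence is across all of them. *)
Definition noise_family (i : edge G + edge G + edge G) : {RV P >-> R} :=
  match i with
  | inl (inl e) => U e
  | inl (inr e) => Ut e
  | inr e => U' e
  end.

Definition omega (p : R) (t : T) : config G := [ffun e => U e t <= p].

Definition omega_noise (p eps : R) (t : T) : config G :=
  [ffun e => if U' e t <= eps then Ut e t <= p else U e t <= p].

End Noise.

(* f restricts to a homeomorphism from A onto B (subspace topologies); the
   values of f outside A are irrelevant. *)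
Definition homeomorphism_on (S T : topologicalType) (A : set S) (B : set T)
    (f : S -> T) : Prop :=
  [/\ set_bij A B f, {within A, continuous f} &
      exists h : T -> S, {in A, cancel f h} /\ {within B, continuous h}].

(* Main.v *)
Require Import Defs.
From HB Require Import structures.
From mathcomp Require Import all_boot all_order all_algebra.
From mathcomp Require Import all_classical all_reals all_analysis.
From mathcomp Require Import measurable_realfun ring lra.
Import Order.TTheory GRing.Theory Num.Theory.
Import numFieldNormedType.Exports.
Local Open Scope classical_set_scope.
Local Open Scope ring_scope.

(** Under the noise, the pairs formed by the state of an edge and its noisy
    state are i.i.d., with both marginals Bernoulli(p) and covariance
    t p (1 - p), where t = 1 - eps.  Such a law on pairs of bits is determined
    by p and t; it is the kernel [kern p t] below.  At the fixed point pstar,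
    the pair of crossing events of one copy of G1 in the two configurations
    has again both marginals Bernoulli(pstar), so its law is
    [kern pstar t'] for some t' = [noise_step t].  As a crossing of G_(k+1) is
    a crossing of G_k whose edges are opened by crossings of independent copies
    of G1 ([crossing_replace]), the pair of crossing events of G_k has law
    [kern pstar] at the k-th iterate of [noise_step] applied to 1 - eps
    ([crossing_law_hgraph]).  The theorem is thus a statement on the iterates
    of a single function of one real variable.

    The Fourier expansion of the crossing event of G1 in the p-biased
    characters of the hypercube gives noise_step t = sum_S a_S t^|S|, where the
    a_S are nonnegative, vanish for S empty, and sum to 1.  The map
    F x = 1 - noise_step (1 - x) ([decorrelation]) then fixes 0 and 1, and its
    derivative at 0 is sum_S |S| a_S.  Monotonicity of the crossing event
    identifies this number with f_1'(pstar) = zeta ([sum_card_weight],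
    [derive_mean]): both are the sum of the influences of the edges.  If every
    a_S with |S| >= 2 vanished, the indicator of crossing would be an affine
    function of the configuration; two edge-disjoint paths exclude this
    ([heavy_weight]), hence zeta > 1 and F x > x on ]0, 1[.

    So 0 is a repelling fixed point of F with multiplier zeta, and 1 attracts
    ]0, 1].  The function g c = lim_k F^k (c / zeta^k) is the Koenigs
    linearization at 0.  The limit exists because F x <= zeta x makes the
    sequence nonincreasing; all its terms are 1-Lipschitz in c, hence so is g
    and c can be replaced by the sequence zeta^k eps_k in the limit.  An
    explicit subsolution c / (1 + B c) keeps g away from 0 and gives
    g c ~ c near 0, which the equation g (zeta c) = F (g c) propagates to
    strict monotonicity on [0, +oo[ and to sup g = 1.  Setting g +oo = 1 gives
    an increasing bijection from [0, +oo] onto [0, 1], hence a homeomorphism. *)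

Set Implicit Arguments.
Unset Strict Implicit.

(** * Crossings, and crossings of a graph with replaced edges *)

Section Crossings.
Variable G : ograph.
Implicit Types (w : config G) (x y : vert G).

Lemma joinsC e x y : @joins G e x y = joins e y x.
Proof. by rewrite /joins orbC. Qed.

Lemma open_adj_sym w : symmetric (open_adj w).
Proof. by move=> x y; apply: eq_existsb => e; rewrite joinsC. Qed.

Lemma open_edge_connect w e : w e -> connect (open_adj w) (src e) (tgt e).
Proof.
move=> we; apply/connect1/existsP; exists e.
by rewrite we /joins !eqxx.
Qed.

Lemma crossing_mono w1 w2 :
  (forall e, w1 e -> w2 e) -> crossing w1 -> crossing w2.
Proof.
move=> w12; apply: connect_sub => x y /existsP[e /andP[we exy]].
by apply/connect1/existsP; exists e; rewrite w12.
Qed.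

Lemma crossing_closed : vtxa G != vtxb G ->
  ~~ crossing ([ffun=> false] : config G).
Proof.
move=> ab; apply/negP => /connectP[[|x s] /=].
  by move=> _ /eqP; rewrite eq_sym (negbTE ab).
by case/andP => /existsP[e]; rewrite ffunE.
Qed.

Lemma crossing_path_edges s :
  simple_path (vtxa G) s (vtxb G) ->
  crossing ([ffun e => e \in path_edges (vtxa G) s] : config G).
Proof.
case/and3P => ps /eqP sb _; apply/connectP; exists s; last by rewrite sb.
clear sb.
set w := [ffun _ => _].
have: forall u, u \in zip (vtxa G :: s) s -> open_adj w u.1 u.2 \/ ~~ adj u.1 u.2.
  move=> u us; have [/existsP[e eu]|] := boolP (adj u.1 u.2); last by right.
  by left; apply/existsP; exists e; rewrite ffunE inE eu andbT; apply/hasP; exists u.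
elim: s (vtxa G) ps {w} (w : config G) => //= y s IHs x /andP[xy ys] w ws.
apply/andP; split.
  by have [] := ws (x, y) (mem_head _ _); rewrite //= xy.
by apply: IHs => // u us; apply: ws; rewrite inE us orbT.
Qed.

End Crossings.

Lemma gdist_refl (G : ograph) (x : vert G) : gdist x x = 0%N.
Proof.
rewrite /gdist; have : (0 < #|vert G|)%N by apply/card_gt0P; exists x.
case: #|_| => //= n _.
by case: existsP => //= -[]; exists (nil_tuple _); rewrite /= eqxx.
Qed.

Definition replaced_config (G H : ograph) (w : config (replace G H)) :
    edge G -> config H :=
  fun e => [ffun f => w (e, f)].

Section CrossingReplace.
Variables G H : ograph.
Hypothesis abH : vtxa H != vtxb H.
Variable w : config (replace G H).

Let wH := replaced_config w.
Let wG : config G := [ffun e => crossing (wH e)].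

Lemma glue_src (e : edge G) : Defs.glue e (vtxa H) = inl (src e) :> vert (replace G H).
Proof. by rewrite /Defs.glue insubF ?eqxx. Qed.

Lemma glue_tgt (e : edge G) : Defs.glue e (vtxb H) = inl (tgt e) :> vert (replace G H).
Proof. by rewrite /Defs.glue insubF ?eqxx ?andbF// eq_sym (negbTE abH). Qed.

Lemma connect_glue e u v : connect (open_adj (wH e)) u v ->
  connect (open_adj w) (Defs.glue e u) (Defs.glue e v).
Proof.
move=> /connectP[s]; elim: s u => [u _ ->|x s IHs u /=]; first exact: connect0.
case/andP => /existsP[f /andP[wf fux]] /IHs/[apply]; apply: connect_trans.
rewrite ffunE in wf; have := open_edge_connect wf.
case/orP: fux => /andP[/eqP<- /eqP<-] //.
by rewrite (sym_connect_sym (@open_adj_sym _ w)).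
Qed.

(* A candidate for the cluster of the vertex a in the replaced graph, described
   through clusters in G and in the copies: a vertex of a copy is in it when it
   is joined inside the copy to an endpoint that belongs to it.  It contains a
   and is stable under open adjacency, so it contains the whole cluster. *)
Let reach (e : edge G) (v : vert H) :=
  (connect (open_adj wG) (vtxa G) (src e) && connect (open_adj (wH e)) (vtxa H) v)
  || (connect (open_adj wG) (vtxa G) (tgt e) && connect (open_adj (wH e)) (vtxb H) v).

Let cluster (u : vert (replace G H)) :=
  match u with
  | inl x => connect (open_adj wG) (vtxa G) x
  | inr (e, i) => reach e (val i)
  end.

Let cluster_glue e v : cluster (Defs.glue e v) = reach e v.
Proof.
have symG := sym_connect_sym (@open_adj_sym _ wG).
have symH := sym_connect_sym (@open_adj_sym _ (wH e)).
have ste : connect (open_adj (wH e)) (vtxa H) (vtxb H) ->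
    connect (open_adj wG) (src e) (tgt e).
  by move=> ce; apply: open_edge_connect; rewrite ffunE.
rewrite /Defs.glue; case: insubP => [i _ <- //|]; rewrite negb_and !negbK /=.
case/orP => /eqP->; rewrite ?eqxx /reach connect0 andbT.
  apply/idP/orP => [->|[|/andP[at_]]]; [by left|by []|].
  by rewrite symH => /ste; rewrite symG; exact: connect_trans.
rewrite eq_sym (negbTE abH); apply/idP/orP => [->|[/andP[as_ /ste]|]//]; first by right.
exact: connect_trans.
Qed.

(** Inside a copy, only the two glued endpoints communicate with the rest of
    the graph, so the only trace that a copy leaves on connections between
    vertices of G is whether it joins its endpoints. *)
Lemma crossing_replace : crossing w = crossing wG.
Proof.
have symG := sym_connect_sym (@open_adj_sym _ wG).
have symR := sym_connect_sym (@open_adj_sym _ w).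
apply/idP/idP.
  suff cl u : cluster u -> connect (open_adj w) u (inl (vtxb G)) ->
      connect (open_adj wG) (vtxa G) (vtxb G) by apply: cl; exact: connect0.
  move=> + /connectP[s]; elim: s u => [u cu _ /= bu|v s IHs u cu /=].
    by rewrite -bu in cu.
  case/andP => /existsP[[e f] /andP[wef uv]]; apply: IHs.
  have step x y : joins f x y -> reach e x -> reach e y.
    move=> fxy; have xy : connect (open_adj (wH e)) x y.
      by apply/connect1/existsP; exists f; rewrite ffunE wef.
    by case/orP => /andP[c1 c2]; apply/orP; [left|right];
      rewrite c1 (connect_trans c2 xy).
  case/orP: uv => /andP[/eqP hu /eqP hv]; move: cu;
    rewrite -hu -hv /= !cluster_glue; apply: step; by rewrite /joins !eqxx ?orbT.
move=> /connectP[s].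
rewrite -[crossing w]/(connect (open_adj w) (inl (vtxa G)) (inl (vtxb G))).
elim: s (vtxa G) => [x _ /= ->|y s IHs x]; first exact: connect0.
case/andP => /existsP[e /andP[we exy]] /IHs/[apply]; apply: connect_trans.
have {we} := we; rewrite ffunE => /connect_glue; rewrite glue_src glue_tgt.
by case/orP: exy => /andP[/eqP<- /eqP<-] //; rewrite symR.
Qed.

End CrossingReplace.

Lemma crossing_single_edge (w : config single_edge) : crossing w = w tt.
Proof.
apply/idP/idP => [/connectP[[|x s] /=]//|wt]; last exact: (open_edge_connect wt).
by case/andP => /existsP[[] /andP[]].
Qed.

(** * Biased Fourier analysis of the noise on the hypercube *)

Section Kernel.
Variables (R : realType) (p : R).
Hypotheses (p_gt0 : 0 < p) (p_lt1 : p < 1).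

Definition bern (q : R) (b : bool) : R := if b then q else 1 - q.
Definition sgn (b : bool) : R := if b then 1 else -1.

(** The law of a pair of bits with Bernoulli(p) marginals and covariance
    t p (1 - p): with probability t both bits are equal, otherwise they are
    independent. *)
Definition kern (t : R) (b c : bool) : R :=
  bern p b * bern p c + t * (p * (1 - p)) * (sgn b * sgn c).

Lemma bern_neq0 b : bern p b != 0.
Proof. by case: b => /=; rewrite ?subr_eq0 gt_eqF. Qed.

Lemma kern1 b c : kern 1 b c = bern p b * (b == c)%:R.
Proof. by case: b; case: c; rewrite /kern /=; ring. Qed.

Variable E : finType.
Implicit Types (f g : {ffun E -> bool} -> R) (S : {set E}) (x y : {ffun E -> bool}).

Definition mean f : R := \sum_x f x * \prod_e bern p (x e).

(** Up to the factor (p (1 - p))^(|S| / 2), the coefficient of f on the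
    orthonormal p-biased character indexed by S.  Leaving the factor out avoids
    square roots: [sgn b / bern p b] is a multiple of the character of one bit. *)
Definition fourier f S : R :=
  \sum_x f x * \prod_e (if e \in S then sgn (x e) else bern p (x e)).

Lemma prod_kern_term S (a : R) x y :
  \prod_e (if e \in S then a * (sgn (x e) * sgn (y e))
           else bern p (x e) * bern p (y e)) =
  a ^+ #|S| * ((\prod_e (if e \in S then sgn (x e) else bern p (x e))) *
               \prod_e (if e \in S then sgn (y e) else bern p (y e))).
Proof.
rewrite -prodr_const [X in _ = X * _]big_mkcond/= -!big_split/=.
by apply: eq_bigr => e _; case: ifP => _; rewrite ?mul1r.
Qed.

Lemma prod_kern t x y : \prod_e kern t (x e) (y e) =
  \sum_(S : {set E}) (t * (p * (1 - p))) ^+ #|S| *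
    ((\prod_e (if e \in S then sgn (x e) else bern p (x e))) *
     \prod_e (if e \in S then sgn (y e) else bern p (y e))).
Proof.
under eq_bigr => e _ do rewrite /kern addrC.
rewrite bigA_distr; apply: eq_big => [S|S _]; first by rewrite inE.
exact: prod_kern_term.
Qed.

(** The kernel of one edge is the sum of two product terms, one for the
    constant and one for the biased character; expanding the product over the
    edges shows that the noise acts diagonally, with eigenvalue t^|S|. *)
Lemma correlation_fourier t f g :
  \sum_x \sum_y f x * g y * \prod_e kern t (x e) (y e) =
  \sum_(S : {set E}) (t * (p * (1 - p))) ^+ #|S| * (fourier f S * fourier g S).
Proof.
under eq_bigr => x _ do under eq_bigr => y _ do rewrite prod_kern big_distrr/=.
under eq_bigr => x _ do rewrite exchange_big.
rewrite exchange_big /=; apply: eq_bigr => S _.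
rewrite /fourier big_distrlr /= big_distrr/=; apply: eq_bigr => x _.
by rewrite big_distrr/=; apply: eq_bigr => y _; ring.
Qed.

Lemma fourier0 f : fourier f finset.set0 = mean f.
Proof. by apply: eq_bigr => x _; under eq_bigr do rewrite inE. Qed.

Lemma fourier1 f e : fourier f [set e]%SET =
  \sum_x f x * (sgn (x e) * \prod_(e' | e' != e) bern p (x e')).
Proof.
apply: eq_bigr => x _; rewrite (bigD1 e)//= inE eqxx; congr (_ * (_ * _)).
by apply: eq_bigr => e' /negbTE ne; rewrite inE ne.
Qed.

Lemma fourier_cst (S : {set E}) : S != finset.set0 -> fourier (fun=> 1) S = 0.
Proof.
case/set0Pn => e eS; rewrite /fourier.
under eq_bigr => x _ do rewrite mul1r.
rewrite -(bigA_distr_bigA (fun e b => if e \in S then sgn b else bern p b)).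
by rewrite (bigD1 e)//= eS big_bool/= subrr mul0r.
Qed.

Lemma mean_cst : mean (fun=> 1) = 1.
Proof.
rewrite /mean; under eq_bigr => x _ do rewrite mul1r.
rewrite -(bigA_distr_bigA (fun=> bern p)) big1// => e _.
by rewrite big_bool/= addrC subrK.
Qed.

(** For t = 1 the two configurations coincide almost surely. *)
Lemma correlation1 f g :
  \sum_x \sum_y f x * g y * \prod_e kern 1 (x e) (y e) = mean (fun x => f x * g x).
Proof.
apply: eq_bigr => x _; rewrite (bigD1 x)//= [X in _ + X]big1 ?addr0 => [|y yx].
  by congr (_ * _); apply: eq_bigr => e _; rewrite kern1 eqxx mulr1.
have [e xye] : exists e, x e != y e.
  apply/existsP; rewrite -negb_forall; apply: contra yx => /forallP xy.
  by apply/eqP/ffunP => e; rewrite (eqP (xy e)).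
by rewrite (bigD1 e)//= kern1 (negbTE xye) mulr0 mul0r mulr0.
Qed.

Lemma plancherel f g : mean (fun x => f x * g x) =
  \sum_(S : {set E}) (p * (1 - p)) ^+ #|S| * (fourier f S * fourier g S).
Proof.
by rewrite -correlation1 correlation_fourier; apply: eq_bigr => S _; rewrite mul1r.
Qed.

(** Plancherel against the point mass at y. *)
Lemma fourier_inversion f y : f y =
  \sum_(S : {set E}) (p * (1 - p)) ^+ #|S| *
    (fourier f S * \prod_(e in S) (sgn (y e) / bern p (y e))).
Proof.
have W0 : \prod_e bern p (y e) != 0 by apply/prodf_neq0 => e _; exact: bern_neq0.
pose g x : R := (x == y)%:R / \prod_e bern p (y e).
have big_delta (h : {ffun E -> bool} -> R) :
    \sum_x g x * h x = h y / \prod_e bern p (y e).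
  rewrite (bigD1 y)//= big1 => [|x /negbTE xy]; last by rewrite /g xy !mul0r.
  by rewrite /g eqxx addr0 div1r mulrC.
have : mean (fun x => f x * g x) = f y.
  rewrite /mean; under eq_bigr => x _ do rewrite (mulrC (f x)) -mulrA.
  by rewrite big_delta mulfK.
move=> <-; rewrite plancherel; apply: eq_bigr => S _; congr (_ * (_ * _)).
rewrite /fourier big_delta -prodf_div [RHS]big_mkcond; apply: eq_bigr => e _.
by case: ifP => // _; rewrite divff// bern_neq0.
Qed.

(** The product rule: this is the derivative at X = 1 of the product over e of
    d e X + c e, once expanded and once differentiated factor by factor. *)
Lemma sum_card_prod (c d : E -> R) :
  \sum_(S : {set E}) #|S|%:R * \prod_e (if e \in S then d e else c e) =
  \sum_e d e * \prod_(e' | e' != e) (d e' + c e').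
Proof.
transitivity (\sum_(S : {set E}) \sum_e
    \prod_e' (if e' \in S then d e' else if e' == e then 0 else c e')).
  apply: eq_bigr => S _; rewrite -sum1_card natr_sum big_mkcond big_distrl/=.
  apply: eq_bigr => e _; have [eS|eS] := boolP (e \in S).
    rewrite mul1r; apply: eq_bigr => e' _.
    by case: ifPn => // e'S; case: eqP => // ee'; rewrite ee' eS in e'S.
  by rewrite mul0r (bigD1 e)//= (negbTE eS) eqxx mul0r.
rewrite exchange_big/=; apply: eq_bigr => e _.
transitivity (\prod_e' (d e' + (if e' == e then 0 else c e'))).
  by rewrite bigA_distr; apply: eq_bigl => S; rewrite inE.
rewrite (bigD1 e)//= eqxx addr0; congr (_ * _).
by apply: eq_bigr => e' /negbTE ->.
Qed.

(** The derivative at t = 1 of the correlation: one edge feels the noise to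
    first order and all the others agree in the two configurations. *)
Lemma sum_card_fourier f :
  \sum_(S : {set E}) #|S|%:R * ((p * (1 - p)) ^+ #|S| * (fourier f S * fourier f S)) =
  p * (1 - p) * \sum_e \sum_x f x * \sum_y f y * (sgn (x e) * sgn (y e) *
    \prod_(e' | e' != e) kern 1 (x e') (y e')).
Proof.
transitivity (\sum_x \sum_y f x * f y * \sum_(S : {set E}) #|S|%:R *
    \prod_e (if e \in S then p * (1 - p) * (sgn (x e) * sgn (y e))
             else bern p (x e) * bern p (y e))).
  under [RHS]eq_bigr => x _ do under eq_bigr => y _ do rewrite big_distrr/=.
  under [RHS]eq_bigr => x _ do rewrite exchange_big.
  rewrite [RHS]exchange_big /=; apply: eq_bigr => S _.
  rewrite /fourier big_distrlr /= !big_distrr/=; apply: eq_bigr => x _.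
  by rewrite !big_distrr/=; apply: eq_bigr => y _; rewrite prod_kern_term; ring.
under eq_bigr => x _ do under eq_bigr => y _ do rewrite sum_card_prod big_distrr/=.
under eq_bigr => x _ do rewrite exchange_big.
rewrite exchange_big big_distrr/=; apply: eq_bigr => e _.
rewrite big_distrr/=; apply: eq_bigr => x _.
rewrite !big_distrr/=; apply: eq_bigr => y _.
rewrite (eq_bigr (fun e' => kern 1 (x e') (y e'))); first by ring.
by move=> e' _; rewrite /kern; ring.
Qed.

Definition flip (e : E) x : {ffun E -> bool} :=
  [ffun e' => if e' == e then ~~ x e else x e'].

Lemma flipK e : involutive (flip e).
Proof.
move=> x; apply/ffunP => e'; rewrite !ffunE eqxx.
by case: eqP => [->|//]; rewrite negbK.
Qed.

(** Only x and [flip e x] contribute to the sum over y. *)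
Lemma resample_edge f e x :
  \sum_y f y * (sgn (x e) * sgn (y e) *
    \prod_(e' | e' != e) kern 1 (x e') (y e')) =
  (f x - f (flip e x)) * \prod_(e' | e' != e) bern p (x e').
Proof.
have xfx : flip e x != x.
  by apply/eqP => /ffunP/(_ e); rewrite ffunE eqxx; case: (x e).
rewrite (bigD1 x)//= (bigD1 (flip e x))//= [X in _ + (_ + X)]big1; last first.
  move=> y /andP[yx yfx].
  have [e' /andP[ne' ye']] : exists e', (e' != e) && (x e' != y e').
    apply/existsP; apply: contraR yx; rewrite negb_exists => /forallP xy.
    have xyE e' : e' != e -> x e' = y e'.
      by move=> ne'; have := xy e'; rewrite ne' negbK => /eqP.
    have [xye|xye] := eqVneq (x e) (y e).
      by apply/eqP/ffunP => e'; have [->//|/xyE->] := eqVneq e' e.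
    case/negP: yfx; apply/eqP/ffunP => e'; rewrite ffunE.
    by case: eqVneq => [->|/xyE//]; case: (x e) (y e) xye => -[].
  by rewrite (bigD1 e')//= kern1 (negbTE ye') mulr0 mul0r !mulr0.
have W1 : \prod_(e' | e' != e) kern 1 (x e') (x e') =
    \prod_(e' | e' != e) bern p (x e').
  by apply: eq_bigr => e' _; rewrite kern1 eqxx mulr1.
have W2 : \prod_(e' | e' != e) kern 1 (x e') (flip e x e') =
    \prod_(e' | e' != e) bern p (x e').
  by apply: eq_bigr => e' ne'; rewrite kern1 ffunE (negbTE ne') eqxx mulr1.
by rewrite W1 W2 addr0 ffunE eqxx; case: (x e) => /=; ring.
Qed.

(** The Bernoulli weight of parameter q is [bern p b + (q - p) * sgn b], so the
    mean is a polynomial in q - p whose coefficients are Fourier coefficients. *)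
Lemma mean_taylor f (q : R) :
  \sum_x f x * \prod_e bern q (x e) =
  \sum_(S : {set E}) (q - p) ^+ #|S| * fourier f S.
Proof.
transitivity (\sum_x \sum_(S : {set E}) (q - p) ^+ #|S| *
    (f x * \prod_e (if e \in S then sgn (x e) else bern p (x e)))); last first.
  by rewrite exchange_big/=; apply: eq_bigr => S _; rewrite big_distrr.
apply: eq_bigr => x _.
transitivity (f x * \prod_e ((q - p) * sgn (x e) + bern p (x e))).
  congr (_ * _); apply: eq_bigr => e _; case: (x e) => /=; ring.
rewrite bigA_distr big_distrr/=; apply: eq_big => [S|S _]; first by rewrite inE.
rewrite mulrCA; congr (_ * _).
rewrite -prodr_const [X in _ = X * _]big_mkcond/= -big_split/=.
by apply: eq_bigr => e _; case: ifP => _; rewrite ?mul1r.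
Qed.

(** Only singletons contribute to the first order of [mean_taylor].  This is
    the formula of Margulis and Russo. *)
Lemma derive_mean f :
  derive1 (fun q : R => \sum_x f x * \prod_e bern q (x e)) p =
  \sum_e fourier f [set e]%SET.
Proof.
pose P : {poly R} := \sum_(S : {set E}) fourier f S *: ('X - p%:P) ^+ #|S|.
rewrite (_ : (fun q => _) = horner P); last first.
  apply/funext => q; rewrite mean_taylor horner_sum; apply: eq_bigr => S _.
  by rewrite hornerZ horner_exp !hornerE mulrC.
rewrite -derivE -big_cards1 raddf_sum horner_sum [RHS]big_mkcond/=.
apply: eq_bigr => S _; rewrite derivZ hornerZ deriv_exp hornerMn hornerM.
rewrite derivXsubC hornerC mul1r horner_exp.
rewrite hornerXsubC subrr; case: #|S| => [|[|n]] /=; rewrite ?expr0 ?mulr0n ?mulr0//.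
  by rewrite mulr1n mulr1.
by rewrite expr0n mul0rn mulr0.
Qed.

Section Monotone.
Variable A : pred {ffun E -> bool}.
Hypothesis A_mono : forall x y, (forall e, x e -> y e) -> A x -> A y.
Let f x : R := (A x)%:R.

(** For an increasing event, the probability that e is pivotal is at once a
    quadratic and a linear expression in its indicator.  The summands of the
    difference of the two expressions change sign under flipping e, so it
    vanishes. *)
Lemma influence_fourier e :
  \sum_x f x * \sum_y f y * (sgn (x e) * sgn (y e) *
    \prod_(e' | e' != e) kern 1 (x e') (y e')) = fourier f [set e]%SET.
Proof.
rewrite fourier1; apply/eqP; rewrite -subr_eq0 -sumrB; apply/eqP.
under eq_bigr => x _ do rewrite resample_edge.
set h := BIG_F; suff hN x : h (flip e x) = - h x.
  have : \sum_x h x = - \sum_x h x.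
    rewrite {1}(reindex_inj (inv_inj (flipK e))) -sumrN.
    by apply: eq_bigr => x _; exact: hN.
  by move=> /eqP; rewrite -addr_eq0 -mulr2n mulrn_eq0 => /eqP.
rewrite /h flipK (eq_bigr (fun e' => bern p (x e'))); last first.
  by move=> e' /negbTE ne'; rewrite ffunE ne'.
have fle b : x e = b -> if b then A (flip e x) -> A x else A x -> A (flip e x).
  by case: b => xe; apply: A_mono => e'; rewrite ffunE; case: eqP => // ->; rewrite xe.
have := fle _ erefl; rewrite /f ffunE eqxx.
by case: (x e); case: (A x); case: (A (flip e x)) => //= H;
  rewrite ?(mulr0n, mulr1n); first [ring | by move: (H isT)].
Qed.

(** The spectral mass of the indicator of A on S, divided by the variance
    p (1 - p) of a Bernoulli variable, whence the exponent [#|S|.-1];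
    the mass on the empty set, the square of the mean, is left out. *)
Definition weight (S : {set E}) : R :=
  if S == finset.set0 then 0 else (p * (1 - p)) ^+ #|S|.-1 * fourier f S ^+ 2.

Definition noise_step (t : R) : R := \sum_(S : {set E}) weight S * t ^+ #|S|.

Lemma weight_ge0 S : 0 <= weight S.
Proof.
rewrite /weight; case: ifP => // _; rewrite mulr_ge0 ?sqr_ge0// exprn_ge0//.
by rewrite mulr_ge0 ?subr_ge0// ltW.
Qed.

Lemma weight_card0 S : #|S| = 0%N -> weight S = 0.
Proof. by move/eqP; rewrite finset.cards_eq0 /weight => ->. Qed.

Lemma weightE S (a : R) : S != finset.set0 ->
  a ^+ #|S| * (p * (1 - p)) ^+ #|S| * (fourier f S * fourier f S) =
  p * (1 - p) * (weight S * a ^+ #|S|).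
Proof.
move=> S0; rewrite /weight (negbTE S0).
rewrite -card_gt0 in S0; case: #|S| S0 => // n _.
by rewrite exprS [in LHS](exprS (p * (1 - p))) /=; ring.
Qed.

Let var_gt0 : 0 < p * (1 - p).
Proof. by rewrite mulr_gt0// subr_gt0. Qed.

(** The total influence, computed from the spectrum and as the derivative of
    the probability of A. *)
Lemma sum_card_weight :
  \sum_(S : {set E}) #|S|%:R * weight S = \sum_e fourier f [set e]%SET.
Proof.
apply: (mulfI (lt0r_neq0 var_gt0)).
rewrite -(eq_bigr _ (fun e _ => influence_fourier e)) -sum_card_fourier.
rewrite big_distrr/=; apply: eq_bigr => S _.
have [->|S0] := eqVneq S finset.set0; first by rewrite finset.cards0 !mul0r mulr0.
rewrite mulrCA; congr (_ * _).
by have := weightE 1 S0; rewrite !expr1n mul1r mulr1 => ->.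
Qed.

Hypothesis mean_f : mean f = p.

(** When A has probability p, its indicators in the two configurations are
    again a pair of Bernoulli(p) bits, so that only the covariance remains to be
    computed.  Complementing A changes the sign of all nonconstant Fourier
    coefficients, hence the four values of (b, c) are treated at once. *)
Lemma correlation_step t b c :
  \sum_x \sum_y (A x == b)%:R * (A y == c)%:R * \prod_e kern t (x e) (y e) =
  kern (noise_step t) b c.
Proof.
rewrite (correlation_fourier t (fun x => (A x == b)%:R) (fun x => (A x == c)%:R)).
have fb b' x : (A x == b')%:R = sgn b' * f x + (~~ b')%:R * 1.
  by rewrite /f; case: (A x) b' => -[] /=;
    rewrite ?(mul0r, mulr0, mul1r, mulN1r, addr0, add0r, addNr).
have fourierD b' S : fourier (fun x => (A x == b')%:R) S =
    sgn b' * fourier f S + (~~ b')%:R * fourier (fun=> 1) S.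
  rewrite /fourier !big_distrr/= -big_split/=.
  by apply: eq_bigr => x _; rewrite fb mul1r mulr1 mulrDl mulrA.
have F0 b' : fourier (fun x => (A x == b')%:R) finset.set0 = bern p b'.
  rewrite fourierD !fourier0 mean_f mean_cst; case: b' => /=;
    rewrite ?(mul0r, mul1r, mulN1r, addr0)//.
  by rewrite addrC.
have FS b' S : S != finset.set0 ->
    fourier (fun x => (A x == b')%:R) S = sgn b' * fourier f S.
  by move=> S0; rewrite fourierD fourier_cst// mulr0 addr0.
rewrite (bigD1 finset.set0)//= !F0 finset.cards0 expr0 mul1r.
rewrite /kern /noise_step; congr (_ + _).
rewrite [X in _ = X * _ * _](bigD1 finset.set0)//= weight_card0 ?finset.cards0//.
rewrite mul0r add0r !big_distrl/=; apply: eq_bigr => S S0.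
have wE := weightE t S0; rewrite !FS// exprMn.
transitivity (t ^+ #|S| * (p * (1 - p)) ^+ #|S| * (fourier f S * fourier f S)
  * (sgn b * sgn c)); first by ring.
by rewrite wE; ring.
Qed.

(** Parseval: the variance of the indicator of A is p (1 - p). *)
Lemma sum_weight : \sum_(S : {set E}) weight S = 1.
Proof.
have := correlation_step 1 true true.
rewrite (correlation1 (fun x => (A x == true)%:R) (fun x => (A x == true)%:R)).
have -> : mean (fun x => (A x == true)%:R * (A x == true)%:R) = p.
  by rewrite -[RHS]mean_f; apply: eq_bigr => x _; rewrite eqb_id -natrM mulnb andbb.
have -> : noise_step 1 = \sum_(S : {set E}) weight S.
  by apply: eq_bigr => S _; rewrite expr1n mulr1.
rewrite /kern /= !mulr1 => pE; apply: (mulIf (lt0r_neq0 var_gt0)).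
rewrite mul1r; apply: (addrI (p * p)); rewrite -pE; ring.
Qed.

(** If no S of cardinal at least 2 carried mass, the indicator of A would be
    affine.  As x and x' are disjoint, its values would then satisfy
    A x + A x' = A (x or x') + A 0, that is 2 = 1. *)
Lemma heavy_weight x x' :
  A x -> A x' -> (forall e, ~~ (x e && x' e)) -> ~~ A [ffun=> false] ->
  exists2 S : {set E}, (1 < #|S|)%N & 0 < weight S.
Proof.
move=> Ax Ax' xx' A0.
have [[S S2 wS]|no] := pselect (exists2 S : {set E}, (1 < #|S|)%N & weight S != 0).
  by exists S => //; rewrite lt_def wS weight_ge0.
have F0 (S : {set E}) : (1 < #|S|)%N -> fourier f S = 0.
  move=> S2; apply/eqP; rewrite -sqrf_eq0; apply: contrapT => /negP FS.
  apply: no; exists S => //; rewrite /weight ifF; last first.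
    by apply/eqP => S0; rewrite S0 finset.cards0 in S2.
  by rewrite mulf_neq0// expf_neq0// lt0r_neq0.
pose x'' := [ffun e => x e || x' e].
have : f x + f x' - f x'' - f [ffun=> false] = 0.
  rewrite 4!(fourier_inversion f) -big_split/= -!sumrB big1// => S _.
  rewrite -!mulrDr -!mulrBr.
  have [/F0->|] := ltnP 1 #|S|; first by ring.
  rewrite leq_eqVlt => /orP[/cards1P[e ->]|].
    rewrite !big_set1 !ffunE; have := xx' e.
    by case: (x e); case: (x' e) => //= _; ring.
  rewrite ltnS leqn0 finset.cards_eq0 => /eqP ->.
  by rewrite !big_set0; ring.
have Ax'' : A x'' by apply: A_mono Ax => e; rewrite ffunE => ->.
rewrite /f Ax Ax' Ax'' (negbTE A0) mulr1n mulr0n => /eqP.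
by rewrite addrK subr0 oner_eq0.
Qed.

End Monotone.

End Kernel.

(** * Self-similarity of the hierarchical graphs *)

Section ProductSums.
Variable R : realType.

(** The image of a product law under a coordinatewise map is the product of
    the images. *)
Lemma sum_pushforward (I Z W : finType) (pi : Z -> W) (w : Z -> R)
    (F : {ffun I -> W} -> R) :
  \sum_(z : {ffun I -> Z}) F [ffun i => pi (z i)] * \prod_i w (z i) =
  \sum_(u : {ffun I -> W}) F u * \prod_i \sum_(z | pi z == u i) w z.
Proof.
rewrite (partition_big (fun z : {ffun I -> Z} => [ffun i => pi (z i)]) predT)//=.
apply: eq_bigr => u _; rewrite bigA_distr_big_dep big_distrr/=.
rewrite (eq_bigl [in family (fun i z => pi z == u i)]) => [|z].
  apply: eq_bigr => z /familyP zu; congr (F _ * _).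
  by apply/ffunP => i; rewrite ffunE; exact/eqP/(zu i).
apply/eqP/familyP => [<- i|zu]; first by rewrite unfold_in ffunE.
by apply/ffunP => i; rewrite ffunE; exact/eqP/(zu i).
Qed.

Lemma sum_curry (I J Z : finType) (w : Z -> R) (F : {ffun I * J -> Z} -> R) :
  \sum_(z : {ffun I * J -> Z}) F z * \prod_ij w (z ij) =
  \sum_(z : {ffun I -> {ffun J -> Z}})
    F [ffun ij => z ij.1 ij.2] * \prod_i \prod_j w (z i j).
Proof.
rewrite (reindex (fun z : {ffun I -> {ffun J -> Z}} => [ffun ij => z ij.1 ij.2])).
  apply: eq_bigr => z _; congr (_ * _); rewrite pair_big/=.
  by apply: eq_bigr => -[i j] _; rewrite ffunE.
exists (fun z : {ffun I * J -> Z} => [ffun i => [ffun j => z (i, j)]]) => z _.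
  by apply/ffunP => i; apply/ffunP => j; rewrite !ffunE.
by apply/ffunP => -[i j]; rewrite !ffunE.
Qed.

Lemma sum_pair_config (E : finType) (K : bool -> bool -> R)
    (F : {ffun E -> bool} -> {ffun E -> bool} -> R) :
  \sum_x \sum_y F x y * \prod_e K (x e) (y e) =
  \sum_(z : {ffun E -> bool * bool})
    F [ffun e => (z e).1] [ffun e => (z e).2] * \prod_e K (z e).1 (z e).2.
Proof.
rewrite pair_big/=.
rewrite (reindex (fun z : {ffun E -> bool * bool} =>
  ([ffun e => (z e).1], [ffun e => (z e).2]))).
  by apply: eq_bigr => z _ /=; congr (_ * _); apply: eq_bigr => e _; rewrite !ffunE.
exists (fun xy : {ffun E -> bool} * {ffun E -> bool} =>
  [ffun e => (xy.1 e, xy.2 e)]) => [z _|[x y] _].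
  by apply/ffunP => e; rewrite !ffunE; case: (z e).
by congr pair; apply/ffunP => e; rewrite !ffunE.
Qed.

Section Hierarchy.
Variables (p : R) (G1 : ograph).
Hypothesis ab : vtxa G1 != vtxb G1.
Hypothesis fix_p : crossing_prob G1 p = p.

Lemma crossing_probE (q : R) : crossing_prob G1 q =
  \sum_(x : {ffun edge G1 -> bool}) (crossing x)%:R * \prod_e bern q (x e).
Proof.
rewrite /crossing_prob big_mkcond; apply: eq_bigr => x _.
by case: (crossing x); rewrite ?mul1r ?mul0r.
Qed.

(** Replacing every edge by a copy of G1 amounts to replacing the law of the
    pair of states of an edge by the law of the pair of crossings of a copy. *)
Lemma crossing_law_replace (G : ograph) (t : R) (b c : bool) :
  \sum_(x : config (replace G G1)) \sum_(y : config (replace G G1))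
    (crossing x == b)%:R * (crossing y == c)%:R * \prod_e kern p t (x e) (y e) =
  \sum_(x : config G) \sum_(y : config G)
    (crossing x == b)%:R * (crossing y == c)%:R *
    \prod_e kern p (noise_step p (@crossing G1) t) (x e) (y e).
Proof.
rewrite !sum_pair_config.
rewrite (sum_curry (fun z => kern p t z.1 z.2)
  (fun z : {ffun edge G * edge G1 -> bool * bool} =>
   (crossing ([ffun e => (z e).1] : config (replace G G1)) == b)%:R *
   (crossing ([ffun e => (z e).2] : config (replace G G1)) == c)%:R)).
pose pi (z : {ffun edge G1 -> bool * bool}) :=
  (crossing ([ffun e => (z e).1] : config G1),
   crossing ([ffun e => (z e).2] : config G1)).
pose w (z : {ffun edge G1 -> bool * bool}) := \prod_j kern p t (z j).1 (z j).2.
rewrite (eq_bigr (fun u : {ffun edge G -> bool * bool} =>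
  (crossing ([ffun e => (u e).1] : config G) == b)%:R *
  (crossing ([ffun e => (u e).2] : config G) == c)%:R *
  \prod_e \sum_(z | pi z == u e) w z)) => [|u _].
  rewrite -(sum_pushforward pi w (fun u =>
    (crossing ([ffun e => (u e).1] : config G) == b)%:R *
    (crossing ([ffun e => (u e).2] : config G) == c)%:R)).
  apply: eq_bigr => z _; congr (_ * _); rewrite !(crossing_replace ab).
  congr (_ * _); congr (nat_of_bool (_ == _))%:R; congr crossing;
    apply/ffunP => e; rewrite !ffunE /=; congr crossing;
    by apply/ffunP => f; rewrite !ffunE.
congr (_ * _); apply: eq_bigr => e _.
rewrite -(@correlation_step _ _ _ (@crossing G1)); last first.
  by rewrite -[RHS]fix_p crossing_probE.
rewrite sum_pair_config [RHS]big_mkcond; apply: eq_bigr => z _.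
rewrite [in RHS](surjective_pairing (u e)) xpair_eqE.
by case: eqP => _; case: eqP => _; rewrite ?mul1r ?mul0r.
Qed.

Lemma crossing_law_hgraph k (t : R) (b c : bool) :
  \sum_(x : config (hgraph G1 k)) \sum_(y : config (hgraph G1 k))
    (crossing x == b)%:R * (crossing y == c)%:R * \prod_e kern p t (x e) (y e) =
  kern p (iter k (noise_step p (@crossing G1)) t) b c.
Proof.
elim: k t => [|k IHk] t; last by rewrite iterSr -IHk -crossing_law_replace.
rewrite sum_pair_config.
rewrite (reindex (fun u : bool * bool => [ffun=> u] : {ffun unit -> bool * bool})).
  rewrite (bigD1 (b, c))//= [X in _ + X]big1 => [|[b' c'] /=]; last first.
    rewrite xpair_eqE !crossing_single_edge !ffunE /=.
    by case: eqP => _; case: eqP => //= _ _; rewrite ?mul0r ?mulr0 ?mul0r.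
  rewrite !crossing_single_edge !ffunE /= !eqxx !mul1r addr0.
  by rewrite (big_pred1 tt) => [|[]//]; rewrite ffunE.
exists (fun z : {ffun unit -> bool * bool} => z tt) => [u _|z _]; first by rewrite ffunE.
by apply/ffunP => -[]; rewrite ffunE.
Qed.

End Hierarchy.

(** Integrates out the three uniform variables of each edge, which enter only
    through their comparison with the thresholds p, p and eps: the state and the
    noisy state of an edge follow the kernel of correlation 1 - eps. *)
Lemma noise_kern (p eps : R) (E : finType)
    (F : {ffun E -> bool} -> {ffun E -> bool} -> R) :
  \sum_(v : {ffun E + E + E -> bool})
    F [ffun e => v (inl (inl e))]
      [ffun e => if v (inr e) then v (inl (inr e)) else v (inl (inl e))] *
    \prod_i bern (match i with inr _ => eps | inl _ => p end) (v i) =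
  \sum_x \sum_y F x y * \prod_e kern p (1 - eps) (x e) (y e).
Proof.
pose pi (u : bool * bool * bool) := (u.1.1, if u.2 then u.1.2 else u.1.1).
pose w (u : bool * bool * bool) := bern p u.1.1 * bern p u.1.2 * bern eps u.2.
rewrite sum_pair_config.
rewrite (reindex (fun u : {ffun E -> bool * bool * bool} => [ffun i : E + E + E =>
   match i with
   | inl (inl e) => (u e).1.1
   | inl (inr e) => (u e).1.2
   | inr e => (u e).2
   end])); last first.
  exists (fun v : {ffun E + E + E -> bool} =>
    [ffun e => (v (inl (inl e)), v (inl (inr e)), v (inr e))]).
    by move=> u _; apply/ffunP => e; rewrite !ffunE; case: (u e) => -[].
  by move=> v _; apply/ffunP => -[[e|e]|e]; rewrite !ffunE.
transitivity (\sum_(u : {ffun E -> bool * bool * bool})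
   F [ffun e => ([ffun e => pi (u e)] e).1] [ffun e => ([ffun e => pi (u e)] e).2]
   * \prod_e w (u e)).
  apply: eq_bigr => u _; congr (F _ _ * _).
  - by apply/ffunP => e; rewrite !ffunE.
  - by apply/ffunP => e; rewrite !ffunE.
  rewrite !big_sumType/= -!big_split/=; apply: eq_bigr => e _.
  by rewrite !ffunE.
rewrite (sum_pushforward pi w (fun z => F [ffun e => (z e).1] [ffun e => (z e).2])).
apply: eq_bigr => z _; congr (_ * _); apply: eq_bigr => e _.
have big3 (h : bool * bool * bool -> R) :
    \sum_u h u = \sum_b \sum_c \sum_d h (b, c, d).
  by rewrite pair_bigA/= pair_bigA/=; apply: eq_bigr => -[[]].
rewrite big_mkcond/= big3 !big_bool /pi /w /kern.
by case: (z e) => -[] [] /=; ring.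
Qed.

End ProductSums.

(** * From independent uniform variables to sums over configurations *)

Section NoiseSpace.
Context d (T : measurableType d) (R : realType) (P : probability T R).

Lemma uniform_prob_itvNy (q : R) : 0 <= q <= 1 ->
  uniform_prob (@ltr01 R) `]-oo, q] = q%:E.
Proof.
case/andP => q0 q1; rewrite /uniform_prob integral_uniform_pdf.
rewrite (_ : `]-oo, q] `&` _ = `[0, q]%classic); last first.
  apply/seteqP; split => x /=; rewrite !in_itv/=; first by case=> xq /andP[-> _].
  by case/andP => x0 xq; rewrite xq x0 (le_trans xq q1).
rewrite (eq_integral (fun=> 1%:E)); last first.
  move=> x; rewrite inE/= in_itv/= /uniform_pdf => /andP[x0 xq].
  by rewrite x0 (le_trans xq q1) subr0 invr1.
rewrite integral_cst//= mul1e lebesgue_measure_itv/= lte_fin.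
have [_|q_le0] := ltP 0 q; first by rewrite oppr0 adde0.
by congr EFin; apply/le_anti; rewrite q0 q_le0.
Qed.

Variables (I : finType) (X : I -> {RV P >-> R}) (q : I -> R).
Hypotheses (X_iid : iid_uniform X) (q01 : forall i, 0 <= q i <= 1).

Let thr (t : T) : {ffun I -> bool} := [ffun i => X i t <= q i].
Let box (v : {ffun I -> bool}) (i : I) : set R :=
  if v i then `]-oo, q i]%classic else ~` `]-oo, q i]%classic.

Let measurable_box v i : measurable (box v i).
Proof. by rewrite /box; case: ifP => _ //; apply: measurableC. Qed.

Let thr_preimage v : [set t | thr t = v] =
  [set t | forall i, i \in [set: I]%SET -> box v i (X i t)].
Proof.
apply/seteqP; split => t /= => [<- i _|tv].
  by rewrite /box ffunE; case: ifPn => /=; rewrite in_itv//= => /negP.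
apply/ffunP => i; have := tv i; rewrite inE ffunE /box => /(_ isT).
by case: (v i) => /=; rewrite in_itv/= => // /negP/negbTE.
Qed.

Let measurable_thr v : measurable [set t | thr t = v].
Proof.
rewrite thr_preimage (_ : mkset _ = \bigcap_(i in [set: I]) (X i @^-1` box v i)).
  apply: fin_bigcap_measurable; first exact: finite_finset.
  move=> i _; exact: measurable_funPTI.
by apply/seteqP; split => t /= H i; [move=> _|move=> _]; apply: H.
Qed.

(** Independence gives the law of the finitely many indicators of the events
    X i <= q i, and the expectation is a finite sum over their values. *)
Lemma expectation_thresholds (F : {ffun I -> bool} -> R) : (forall v, 0 <= F v) ->
  ('E_P[fun t => F [ffun i => (X i t <= q i)%R]] =
   (\sum_v F v * \prod_i bern (q i) (v i))%:E)%E.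
Proof.
move=> F0; rewrite unlock.
transitivity (\int[P]_t \sum_(v <- index_enum {ffun I -> bool})
    ((F v)%:E * (\1_[set t | thr t = v] t)%:E))%E.
  apply: eq_integral => t _.
  rewrite (bigD1_seq (thr t))//= ?index_enum_uniq ?mem_index_enum//.
  rewrite big1 => [|v vt]; first by rewrite indicE mem_set// mule1 adde0.
  by rewrite indicE memNset ?mule0// => /= tv; rewrite tv eqxx in vt.
rewrite ge0_integral_sum//; last 2 first.
- move=> v; apply: measurable_funeM; apply/measurable_EFinP.
  exact: measurable_indic.
- by move=> v t _; rewrite mule_ge0// lee_fin.
rewrite -sumEFin; apply: eq_bigr => v _.
rewrite ge0_integralZl_EFin//; last exact/measurable_EFinP/measurable_indic.
rewrite integral_indic// setIT EFinM; congr (_ * _)%E.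
rewrite thr_preimage.
rewrite [LHS](proj1 X_iid [set: I]%SET (box v) (measurable_box v)); congr EFin.
apply: eq_big => [i|i _]; first by rewrite inE.
have Pq : P (X i @^-1` `]-oo, q i]) = (q i)%:E.
  rewrite -[LHS]/(distribution P (X i) `]-oo, q i]).
  by rewrite (proj2 X_iid)// uniform_prob_itvNy.
rewrite /box; case: (v i); first by rewrite Pq.
rewrite preimage_setC probability_setC ?Pq//.
exact: (@measurable_funPTI _ _ _ _ (X i) `]-oo, q i]%classic).
Qed.

End NoiseSpace.

Lemma expectation_crossings (R : realType) d (T : measurableType d)
    (P : probability T R) (G1 : ograph) (p eps : R) k
    (U Ut U' : edge (hgraph G1 k) -> {RV P >-> R}) :
  0 < p -> p < 1 -> vtxa G1 != vtxb G1 -> crossing_prob G1 p = p ->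
  0 <= eps <= 1 -> iid_uniform (noise_family U Ut U') ->
  ('E_P[fun t => (((crossing (omega U p t))%:R *
                  (crossing (omega_noise U Ut U' p eps t))%:R)%R : R)] =
   (kern p (iter k (noise_step p (@crossing G1)) (1 - eps)) true true)%:E)%E.
Proof.
move=> p0 p1 ab fix_p eps01 iid.
rewrite -(crossing_law_hgraph ab fix_p) -noise_kern.
pose I := (edge (hgraph G1 k) + edge (hgraph G1 k) + edge (hgraph G1 k))%type.
pose F (v : {ffun I -> bool}) : R :=
  (crossing ([ffun e => v (inl (inl e))] : config (hgraph G1 k)) == true)%:R *
  (crossing ([ffun e => if v (inr e) then v (inl (inr e)) else v (inl (inl e))]
     : config (hgraph G1 k)) == true)%:R.
rewrite -[X in X%:E]/(\sum_v F v * _) -(expectation_thresholds iid).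
- congr expectation; apply/funext => t; rewrite /F !eqb_id.
  congr (_ * _); congr (nat_of_bool _)%:R; congr crossing; apply/ffunP => e;
    by rewrite !ffunE.
- by case=> // _; rewrite !ltW.
- by move=> v; rewrite mulr_ge0.
Qed.

(** * Linearization at a repelling fixed point *)

Section Linearization.
Variables (R : realType) (zeta M : R) (F : R -> R).
Hypotheses (zeta_gt1 : 1 < zeta) (M_gt0 : 0 < M).
Hypothesis F0 : F 0 = 0.
Hypothesis F_lip : forall x y, x <= y -> 0 <= F y - F x <= zeta * (y - x).
Hypothesis F_le1 : forall x, F x <= 1.
Hypothesis F_lower : forall x, 0 <= x -> zeta * x - M * x ^+ 2 <= F x.
Hypothesis F_gt : forall x, 0 < x < 1 -> x < F x.
Hypothesis F_inj : forall x y, 0 <= x -> x < y -> y <= 1 -> F x < F y.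

Let zeta_gt0 : 0 < zeta. Proof. exact: lt_trans ltr01 zeta_gt1. Qed.
Let zetaX_gt0 k : 0 < zeta ^+ k. Proof. by rewrite exprn_gt0. Qed.

Let zetaE k c : zeta * (c / zeta ^+ k.+1) = c / zeta ^+ k.
Proof. by rewrite exprS invfM mulrCA mulVKf// gt_eqF. Qed.

(** Approximations of the Koenigs function: start at distance c / zeta^k from
    the repelling fixed point and iterate k times. *)
Definition scaled_iter k c : R := iter k F (c / zeta ^+ k).

Let iter_lip k x y : x <= y ->
  0 <= iter k F y - iter k F x <= zeta ^+ k * (y - x).
Proof.
move=> xy; elim: k => [|k /andP[IH0 IH1]] /=.
  by rewrite expr0 mul1r lexx subr_ge0 xy.
rewrite subr_ge0 in IH0; have /andP[-> H] := F_lip IH0.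
by rewrite (le_trans H)// exprS -mulrA ler_pM2l.
Qed.

Let iter_mono k x y : x <= y -> iter k F x <= iter k F y.
Proof. by move/(iter_lip k)/andP => [+ _]; rewrite subr_ge0. Qed.

(** F^k is zeta^k-Lipschitz, which the scaling by zeta^-k compensates. *)
Lemma scaled_iter_lip k x y : x <= y ->
  0 <= scaled_iter k y - scaled_iter k x <= y - x.
Proof.
move=> xy; have : x / zeta ^+ k <= y / zeta ^+ k by rewrite ler_pM2r ?invr_gt0.
rewrite /scaled_iter => /(iter_lip k)/andP[-> H]; rewrite (le_trans H)//.
by rewrite -mulrBl mulrCA mulfV ?mulr1// gt_eqF.
Qed.

Lemma scaled_iter_ge0 k c : 0 <= c -> 0 <= scaled_iter k c.
Proof.
move=> c0; have /andP[+ _] := scaled_iter_lip k c0.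
rewrite subr_ge0; apply: le_trans; rewrite /scaled_iter mul0r.
by suff -> : iter k F 0 = 0 by []; elim: k => //= k ->.
Qed.

(** Since F x <= zeta x for x >= 0. *)
Lemma scaled_iter_le k c : 0 <= c -> scaled_iter k.+1 c <= scaled_iter k c.
Proof.
move=> c0; rewrite /scaled_iter iterSr; apply: iter_mono.
have c0' : 0 <= c / zeta ^+ k.+1 by rewrite divr_ge0// ltW.
by have /andP[_] := F_lip c0'; rewrite F0 !subr0 zetaE.
Qed.

Let B := M / (zeta - 1).
Let B_ge0 : 0 <= B. Proof. by apply: divr_ge0; rewrite ?subr_ge0 ltW. Qed.
Let u (x : R) := x / (1 + B * x).

Let den_gt0 x : 0 <= x -> 0 < 1 + B * x.
Proof. by move=> x0; rewrite ltr_wpDr// mulr_ge0. Qed.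

(* The homography [u] solves the Schroeder equation of x |-> zeta x / (1 + M x),
   a map that becomes affine after inversion and bounds F from below on the
   values of [u]. *)
Let u_sub x : 0 <= x -> u (zeta * x) <= F (u x).
Proof.
move=> x0; have D0 := den_gt0 x0.
have ux0 : 0 <= u x by rewrite divr_ge0// ltW.
apply: le_trans (F_lower ux0).
have D1 : 0 < 1 + B * (zeta * x) by rewrite den_gt0// mulr_ge0// ltW.
have Bz : M = B * (zeta - 1) by rewrite divfK// subr_eq0 gt_eqF.
rewrite /u ler_pdivrMr// -subr_ge0.
suff -> : (zeta * (x / (1 + B * x)) - M * (x / (1 + B * x)) ^+ 2) *
    (1 + B * (zeta * x)) - zeta * x = M * (zeta - 1) * (x / (1 + B * x)) ^+ 2.
  by rewrite mulr_ge0 ?sqr_ge0// mulr_ge0 ?subr_ge0// ltW.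
by rewrite Bz; field; rewrite gt_eqF.
Qed.

Lemma scaled_iter_lower k c : 0 <= c -> u c <= scaled_iter k c.
Proof.
move=> c0; apply: (@le_trans _ _ (iter k F (u (c / zeta ^+ k)))).
  elim: k => [|k IHk]; first by rewrite expr0 divr1.
  apply: (le_trans IHk); rewrite iterSr; apply: iter_mono.
  have := u_sub (divr_ge0 c0 (ltW (zetaX_gt0 k.+1))).
  by rewrite zetaE.
apply: iter_mono; have c0' := divr_ge0 c0 (ltW (zetaX_gt0 k)).
by rewrite /u ler_pdivrMr ?den_gt0// ler_peMr// lerDl mulr_ge0.
Qed.

Definition koenigs c : R := limn (scaled_iter ^~ c).

Lemma scaled_iter_cvg c : 0 <= c -> scaled_iter ^~ c @ \oo --> koenigs c.
Proof.
move=> c0; apply: nonincreasing_is_cvgn.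
  by apply/nonincreasing_seqP => k; exact: scaled_iter_le.
by exists 0 => _ [k _ <-]; exact: scaled_iter_ge0.
Qed.

Lemma koenigs_le k c : 0 <= c -> koenigs c <= scaled_iter k c.
Proof.
move=> c0; apply: nonincreasing_cvgn_ge; last exact: scaled_iter_cvg.
by apply/nonincreasing_seqP => n; exact: scaled_iter_le.
Qed.

Lemma koenigs_lip x y : 0 <= x -> x <= y ->
  0 <= koenigs y - koenigs x <= y - x.
Proof.
move=> x0 xy.
have xyc : (fun k => scaled_iter k y - scaled_iter k x) @ \oo -->
    koenigs y - koenigs x.
  by apply: cvgB; apply: scaled_iter_cvg => //; exact: le_trans xy.
apply/andP; split; [apply: (cvgr_to_ge xyc)|apply: (cvgr_to_le xyc)];
  by apply: nearW => k; have /andP[] := scaled_iter_lip k xy.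
Qed.

Lemma koenigs_mono x y : 0 <= x -> x <= y -> koenigs x <= koenigs y.
Proof. by move=> x0 /(koenigs_lip x0)/andP[+ _]; rewrite subr_ge0. Qed.

Lemma koenigs_ge0 c : 0 <= c -> 0 <= koenigs c.
Proof.
move=> c0; apply: (cvgr_to_ge (scaled_iter_cvg c0)).
by apply: nearW => k; exact: scaled_iter_ge0.
Qed.

Lemma koenigs_le1 c : 0 <= c -> koenigs c <= 1.
Proof. by move=> /(koenigs_le 1)/le_trans; apply; exact: F_le1. Qed.

Lemma koenigs_lower c : 0 <= c -> u c <= koenigs c.
Proof.
move=> c0; apply: (cvgr_to_ge (scaled_iter_cvg c0)).
by apply: nearW => k; exact: scaled_iter_lower.
Qed.

Lemma koenigs_id c : 0 <= c -> koenigs c <= c.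
Proof. by move=> /(koenigs_le 0)/le_trans; apply; rewrite /scaled_iter divr1. Qed.

Lemma koenigs_schroeder c : 0 <= c -> koenigs (zeta * c) = F (koenigs c).
Proof.
move=> c0; have zc0 : 0 <= zeta * c by rewrite mulr_ge0// ltW.
have := scaled_iter_cvg zc0; rewrite -cvg_shiftS.
rewrite (_ : [sequence _]_n = fun k => F (scaled_iter k c)); last first.
  apply/funext => k; rewrite /scaled_iter /= exprS invfM mulrACA mulfV ?mul1r//.
  by rewrite gt_eqF.
move/cvg_unique; apply=> //.
apply: (@squeeze_cvgr _ _ _ _ (cst (F (koenigs c)))
  (fun k => F (koenigs c) + zeta * (scaled_iter k c - koenigs c))).
- apply: nearW => k /=; have /F_lip := koenigs_le k c0.
  by rewrite subr_ge0 lerBlDl.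
- exact: cvg_cst.
rewrite -[X in _ --> X]addr0; apply: cvgD; first exact: cvg_cst.
rewrite -(mulr0 zeta) -(subrr (koenigs c)); apply: cvgM; first exact: cvg_cst.
by apply: cvgB; [exact: scaled_iter_cvg|exact: cvg_cst].
Qed.

(** An equality of the values at x and y would be inherited by x / zeta^n and
    y / zeta^n, as F is injective on [0, 1]; but [koenigs] is tangent to the
    identity at 0, so the ratio of x and y would be 1. *)
Lemma koenigs_lt x y : 0 <= x -> x < y -> koenigs x < koenigs y.
Proof.
move=> x0 xy; have y0 := le_trans x0 (ltW xy).
rewrite lt_neqAle (koenigs_mono x0 (ltW xy)) andbT; apply/eqP => gxy.
have scale0 n z : 0 <= z -> 0 <= z / zeta ^+ n by move=> z0; rewrite divr_ge0// ltW.
have gxyn n : koenigs (x / zeta ^+ n) = koenigs (y / zeta ^+ n).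
  elim: n => [|n IHn]; first by rewrite !divr1.
  move: IHn; rewrite -(zetaE n x) -(zetaE n y) !koenigs_schroeder ?scale0// => FE.
  apply/le_anti/andP; split.
    by rewrite koenigs_mono ?scale0// ler_pM2r ?invr_gt0// ltW.
  rewrite leNgt; apply/negP => lt_xy.
  have := F_inj (koenigs_ge0 (scale0 _ _ x0)) lt_xy (koenigs_le1 (scale0 _ _ y0)).
  by rewrite FE ltxx.
have D0 : 0 < x * B * y + 1.
  by apply: ltr_wpDl => //; apply: mulr_ge0 => //; exact: mulr_ge0.
(* The bounds u z <= koenigs z <= z, at the points y / zeta^n and x / zeta^n. *)
have ineq n : (y - x) / (x * B * y + 1) <= zeta^-1 ^+ n.
  have := le_trans (koenigs_lower (scale0 n y y0)) _.
  move=> /(_ (x / zeta ^+ n)); rewrite -gxyn => /(_ (koenigs_id (scale0 n x x0))).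
  rewrite /u ler_pdivrMr ?den_gt0 ?scale0// => H.
  have : y <= x * (1 + B * (y / zeta ^+ n)).
    by move: H; rewrite mulrAC ler_pM2r ?invr_gt0.
  rewrite exprVn ler_pdivrMr//.
  have zn0 : 0 < (zeta ^+ n)^-1 by rewrite invr_gt0.
  nra.
have : (y - x) / (x * B * y + 1) <= 0.
  have zn : (fun n => zeta^-1 ^+ n) @ \oo --> (0 : R).
    by apply: cvg_expr; rewrite ger0_norm ?invr_ge0 ?ltW// invf_lt1.
  by apply: (cvgr_to_ge zn); exact: nearW.
by rewrite leNgt divr_gt0 ?subr_gt0.
Qed.

(** By the Schroeder equation the supremum L of [koenigs] satisfies F L <= L,
    and L is positive; as F x > x on ]0, 1[, only L = 1 is left. *)
Lemma koenigs_sup v : v < 1 -> exists2 c, 0 <= c & v < koenigs c.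
Proof.
move=> v1; pose S := [set koenigs c | c in [set c | 0 <= c]].
have S1 : ubound S 1 by move=> _ [c c0 <-]; exact: koenigs_le1.
have hS : has_sup S by split; [exists (koenigs 1), 1 => //=|exists 1].
suff supS : 1 <= sup S.
  have v1' : 0 < sup S - v by rewrite subr_gt0 (lt_le_trans v1).
  by have [_ [c c0 <-]] := sup_adherent v1' hS; rewrite subKr; exists c.
rewrite leNgt; apply/negP => L1.
have ubS c : 0 <= c -> koenigs c <= sup S.
  by move=> c0; apply: (sup_upper_bound hS); exists c.
have L0 : 0 < sup S.
  apply: (lt_le_trans _ (ubS 1 _)) => //.
  apply: (lt_le_trans _ (koenigs_lower _)) => //.
  by rewrite /u divr_gt0// den_gt0.
have FL : sup S < F (sup S) by rewrite F_gt ?L0.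
(* A value of g so close to the supremum that F maps it above the supremum. *)
have e0 : 0 < (F (sup S) - sup S) / zeta by rewrite divr_gt0 ?subr_gt0.
have [_ [c c0 <-] cL] := sup_adherent e0 hS.
have := ubS (zeta * c) (mulr_ge0 (ltW zeta_gt0) c0).
rewrite koenigs_schroeder// leNgt => /negP; apply.
have /F_lip/andP[_] := ubS c c0; rewrite lerBlDl -lerBlDr; apply: lt_le_trans.
by rewrite ltrBrDl -ltrBrDr -ltr_pdivlMl// mulrC ltrBlDl -ltrBlDr.
Qed.

(** The intermediate value theorem, for the extension of [koenigs] to the whole
    line that is constant on negative numbers. *)
Lemma koenigs_surj v : 0 <= v -> v < 1 -> exists2 c, 0 <= c & koenigs c = v.
Proof.
move=> v0 v1; have [b b0 vb] := koenigs_sup v1.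
have lip x z : `|koenigs (Num.max 0 x) - koenigs (Num.max 0 z)| <= `|x - z|.
  wlog xz : x z / x <= z.
    by move=> W; have [|/ltW] := leP x z => /W//; rewrite distrC (distrC z).
  have xz' : Num.max 0 x <= Num.max 0 z by rewrite ge_max !le_max lexx xz orbT.
  have x0 : 0 <= Num.max 0 x by rewrite le_max lexx.
  have /andP[g0 g1] := koenigs_lip x0 xz'.
  rewrite distrC ger0_norm// distrC ger0_norm ?subr_ge0//; apply: (le_trans g1).
  by rewrite /Num.max; case: ltP => ?; case: ltP => ?; lra.
have [] := @IVT _ (fun c => koenigs (Num.max 0 c)) 0 b v b0.
- apply: continuous_subspaceT => x; apply/cvgrPdist_le => e e0.
  near=> z; apply: (le_trans (lip x z)).
  by near: z; exact: cvgr_dist_le.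
- have k0 : koenigs 0 = 0 by apply/le_anti; rewrite koenigs_id ?koenigs_ge0.
  rewrite maxxx (max_idPr b0) k0; apply/andP; split.
    by rewrite ge_min v0.
  by rewrite le_max (ltW vb) orbT.
move=> c; rewrite in_itv/= => /andP[c0 _]; rewrite (max_idPr c0) => <-.
by exists c.
Unshelve. all: by end_near. Qed.

Lemma iter_le1 k x : x <= 1 -> iter k F x <= 1.
Proof. by case: k => //= k _; exact: F_le1. Qed.

(** The functions [scaled_iter k] are uniformly Lipschitz, so their pointwise
    convergence can be evaluated along a convergent sequence. *)
Lemma scaled_iter_cvg_fin (c : nat -> R) (c0 : R) :
  (forall k, 0 <= c k) -> c @ \oo --> c0 ->
  (fun k => scaled_iter k (c k)) @ \oo --> koenigs c0.
Proof.
move=> c_ge0 cc0; have c0_ge0 : 0 <= c0.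
  by apply: (cvgr_to_ge cc0); exact: nearW.
have d0 : (fun k => scaled_iter k (c k) - scaled_iter k c0) @ \oo --> 0.
  apply/norm_cvg0P; apply: (@squeeze_cvgr _ _ _ _ (cst 0) (fun k => `|c k - c0|)).
  - apply: nearW => k /=; rewrite normr_ge0 /=.
    have [le|/ltW le] := leP (c k) c0.
      have /andP[g0 g1] := scaled_iter_lip k le.
      by rewrite distrC ger0_norm// distrC ger0_norm ?subr_ge0.
    have /andP[g0 g1] := scaled_iter_lip k le.
    by rewrite ger0_norm// ger0_norm ?subr_ge0.
  - exact: cvg_cst.
  apply/norm_cvg0P.
  by rewrite -(subrr c0); apply: cvgB => //; exact: cvg_cst.
rewrite (_ : (fun k => _) =
    (fun k => (scaled_iter k (c k) - scaled_iter k c0) + scaled_iter k c0));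
  last first.
  by apply/funext => k; rewrite subrK.
by rewrite -[koenigs c0]add0r; apply: cvgD => //; exact: scaled_iter_cvg.
Qed.

(** Along a sequence tending to infinity, [scaled_iter k (c k)] is eventually
    at least [scaled_iter k A], hence at least [koenigs A], for every A. *)
Lemma scaled_iter_cvg_infty (c : nat -> R) :
  (forall k, scaled_iter k (c k) <= 1) ->
  (forall A, \forall k \near \oo, A <= c k) ->
  (fun k => scaled_iter k (c k)) @ \oo --> (1 : R).
Proof.
move=> s1 coo; apply/cvgrPdist_le => e e0.
have [A A0 gA] := @koenigs_sup (1 - e) ltac:(by rewrite ltrBlDr ltrDl).
near=> k; have Ack : A <= c k by near: k; exact: coo.
rewrite ger0_norm ?subr_ge0// lerBlDr -lerBlDl (le_trans (ltW gA))//.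
apply: (le_trans (koenigs_le k A0)).
by have /andP[+ _] := scaled_iter_lip k Ack; rewrite subr_ge0.
Unshelve. all: by end_near. Qed.

End Linearization.

(** * The map of noise parameters for one copy of the graph *)

Section PowerMixture.
Variables (R : realType) (I : finType) (a : I -> R) (n : I -> nat).
Hypothesis a_ge0 : forall i, 0 <= a i.
Hypothesis a_card0 : forall i, n i = 0%N -> a i = 0.
Hypothesis sum_a : \sum_i a i = 1.
Hypothesis heavy : exists2 i, (1 < n i)%N & 0 < a i.

Let s (t : R) := \sum_i a i * t ^+ n i.
Let zeta := \sum_i (n i)%:R * a i.
Let M := \sum_i (n i)%:R ^+ 2 * a i.

(** Extending the map by constants outside [0, 1] makes it monotone and
    Lipschitz on the whole line, so that it can be iterated from any c / zeta^k. *)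
Definition clamp (x : R) := Num.max 0 (Num.min x 1).

(** The map [noise_step] of the correlation t, in the coordinate 1 - t. *)
Definition decorrelation x := 1 - s (1 - clamp x).

Lemma clamp_id x : 0 <= x <= 1 -> clamp x = x.
Proof. by case/andP => x0 x1; rewrite /clamp (min_idPl x1) (max_idPr x0). Qed.

Lemma clamp_cases x :
  [\/ x <= 0 /\ clamp x = 0, 0 <= x <= 1 /\ clamp x = x | 1 <= x /\ clamp x = 1].
Proof.
have [x0|/ltW x0] := leP x 0.
  apply: Or31; split=> //; rewrite /clamp (min_idPl (le_trans x0 ler01)).
  exact/max_idPl.
have [x1|/ltW x1] := leP x 1.
  by apply: Or32; rewrite clamp_id x0.
by apply: Or33; split=> //; rewrite /clamp (min_idPr x1); exact/max_idPr.
Qed.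

Lemma clamp_itv x : 0 <= clamp x <= 1.
Proof. by case: (clamp_cases x) => -[? ->] //; rewrite ?lexx ler01. Qed.

Lemma clamp_lip x y : x <= y -> 0 <= clamp y - clamp x <= y - x.
Proof.
move=> xy; case: (clamp_cases x) => -[hx ->]; case: (clamp_cases y) => -[hy ->];
  apply/andP; lra.
Qed.

Lemma subrX_lip m (v w : R) : 0 <= v -> v <= w -> w <= 1 ->
  0 <= w ^+ m - v ^+ m <= m%:R * (w - v).
Proof.
move=> v0 vw w1; elim: m => [|m /andP[IH0 IH1]].
  by rewrite !expr0 subrr mul0r lexx.
have wm1 : w ^+ m <= 1 by rewrite exprn_ile1// (le_trans v0).
have wm0 : 0 <= w ^+ m by rewrite exprn_ge0// (le_trans v0).
have -> : w ^+ m.+1 - v ^+ m.+1 = w ^+ m * (w - v) + v * (w ^+ m - v ^+ m).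
  by rewrite !exprS; ring.
rewrite -natr1; apply/andP; split; first by rewrite addr_ge0// mulr_ge0// subr_ge0.
by rewrite mulrDl mul1r addrC lerD//; nra.
Qed.

Lemma expr_1subr_le m (x : R) : 0 <= x <= 1 ->
  (1 - x) ^+ m <= 1 - m%:R * x + m%:R ^+ 2 * x ^+ 2.
Proof.
case/andP => x0 x1; elim: m => [|m IH]; first by rewrite expr0; lra.
rewrite exprSr; apply: (@le_trans _ _ ((1 - m%:R * x + m%:R ^+ 2 * x ^+ 2) * (1 - x))).
  by rewrite ler_wpM2r// subr_ge0.
have m0 : 0 <= m%:R :> R by [].
rewrite -natr1 -subr_ge0.
suff -> : 1 - (m%:R + 1) * x + (m%:R + 1) ^+ 2 * x ^+ 2 -
    (1 - m%:R * x + m%:R ^+ 2 * x ^+ 2) * (1 - x) =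
    (m%:R + 1) * x ^+ 2 + m%:R ^+ 2 * x ^+ 3.
  by rewrite addr_ge0// mulr_ge0// ?exprn_ge0// addr_ge0.
ring.
Qed.

Let s1 : s 1 = 1.
Proof. by rewrite -[RHS]sum_a; apply: eq_bigr => i _; rewrite expr1n mulr1. Qed.

Let s0 : s 0 = 0.
Proof.
apply: big1 => i _; case: (posnP (n i)) => [/a_card0->|ni]; first by rewrite mul0r.
by rewrite expr0n gtn_eqF// mulr0.
Qed.

Let s_lip (v w : R) : 0 <= v -> v <= w -> w <= 1 -> 0 <= s w - s v <= zeta * (w - v).
Proof.
move=> v0 vw w1; rewrite -sumrB mulr_suml; apply/andP; split.
  apply: sumr_ge0 => i _; rewrite -mulrBr mulr_ge0//.
  by have /andP[] := subrX_lip (n i) v0 vw w1.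
apply: ler_sum => i _; rewrite -mulrBr (mulrC _ (a i)) -mulrA ler_wpM2l//.
by have /andP[] := subrX_lip (n i) v0 vw w1.
Qed.

Let s_itv t : 0 <= t <= 1 -> 0 <= s t <= 1.
Proof.
case/andP => t0 t1; have := s_lip (lexx 0) t0 t1; have := s_lip t0 t1 (lexx 1).
by rewrite s0 s1 => /andP[? _] /andP[? _]; apply/andP; lra.
Qed.

Lemma decorrelation0 : decorrelation 0 = 0.
Proof. by rewrite /decorrelation clamp_id ?lexx ?ler01// subr0 s1 subrr. Qed.

Lemma decorrelation_le1 x : decorrelation x <= 1.
Proof.
rewrite /decorrelation gerBl; have /andP[c0 c1] := clamp_itv x.
by have /andP[] := @s_itv (1 - clamp x) ltac:(apply/andP; lra).
Qed.

Lemma decorrelation_lip x y : x <= y ->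
  0 <= decorrelation y - decorrelation x <= zeta * (y - x).
Proof.
move=> /clamp_lip/andP[cxy0 cxy1].
have /andP[x0 x1] := clamp_itv x; have /andP[y0 y1] := clamp_itv y.
have zeta0 : 0 <= zeta by apply: sumr_ge0 => i _; rewrite mulr_ge0.
have := @s_lip (1 - clamp y) (1 - clamp x) ltac:(lra) ltac:(lra) ltac:(lra).
move=> /andP[h0 h1].
rewrite /decorrelation; apply/andP; split; first by lra.
have := ler_wpM2l zeta0 cxy1; lra.
Qed.

Lemma mixture_lt_pow (v w : R) : 0 <= v -> v < w -> w <= 1 -> s v < s w.
Proof.
move=> v0 vw w1; have [i ni ai] := heavy; rewrite -subr_gt0 -sumrB (bigD1 i)//=.
apply: ltr_wpDr.
  apply: sumr_ge0 => j _; rewrite -mulrBr mulr_ge0//.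
  by have /andP[] := subrX_lip (n j) v0 (ltW vw) w1.
rewrite -mulrBr mulr_gt0// subr_gt0 ltrXn2r ?nnegrE ?(le_trans v0 (ltW vw))//.
by rewrite -lt0n (ltnW ni).
Qed.

Lemma decorrelation_inj x y : 0 <= x -> x < y -> y <= 1 ->
  decorrelation x < decorrelation y.
Proof.
move=> x0 xy y1; rewrite /decorrelation !clamp_id; try by apply/andP; lra.
by rewrite ltrD2l ltrN2 mixture_lt_pow//; lra.
Qed.

(** Here some mass on exponents at least 2 is essential: with exponent 1 only,
    the map would be the identity. *)
Lemma decorrelation_gt x : 0 < x < 1 -> x < decorrelation x.
Proof.
case/andP => x0 x1; rewrite /decorrelation clamp_id; last by apply/andP; lra.
suff : s (1 - x) < 1 - x by lra.
set t := 1 - x; have t0 : 0 < t by rewrite /t; lra.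
have t1 : t < 1 by rewrite /t; lra.
rewrite -[X in _ < X]mul1r -sum_a mulr_suml.
have [i ni ai] := heavy; rewrite -subr_gt0 -sumrB (bigD1 i)//=.
apply: ltr_wpDr.
  apply: sumr_ge0 => j _; case: (posnP (n j)) => [/a_card0->|nj].
    by rewrite !mul0r subrr.
  by rewrite -mulrBr mulr_ge0// subr_ge0 -{2}(expr1 t) ler_wiXn2l// ltW.
by rewrite -mulrBr mulr_gt0// subr_gt0 -{2}(expr1 t) ltr_iXn2l.
Qed.

Lemma decorrelation_lower x : 0 <= x -> zeta * x - M * x ^+ 2 <= decorrelation x.
Proof.
move=> x0; have zetaM : zeta <= M.
  apply: ler_sum => i _; rewrite ler_wpM2r//.
  by rewrite -natrX ler_nat; case: (n i) => // m; rewrite leq_pmull.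
have zeta0 : 0 <= zeta by apply: sumr_ge0 => i _; rewrite mulr_ge0.
rewrite /decorrelation; case: (clamp_cases x) => -[hx ->].
- have -> : x = 0 by apply/le_anti; rewrite hx.
  by rewrite expr0n !mulr0 !subr0 s1 subrr.
- suff : s (1 - x) <= 1 - zeta * x + M * x ^+ 2 by lra.
  rewrite -[X in _ <= X - _ + _]sum_a /zeta /M !mulr_suml -sumrB -big_split/=.
  apply: ler_sum => i _; have := ler_wpM2l (a_ge0 i) (expr_1subr_le (n i) hx).
  by move=> /le_trans; apply; rewrite le_eqVlt; apply/orP; left; apply/eqP; ring.
rewrite subrr s0 subr0; suff : 0 <= M * x ^+ 2 - zeta * x by lra.
have -> : M * x ^+ 2 - zeta * x = (M - zeta) * x ^+ 2 + zeta * (x * (x - 1)) by ring.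
by rewrite addr_ge0// mulr_ge0 ?subr_ge0 ?exprn_ge0// mulr_ge0 ?subr_ge0.
Qed.


Lemma iter_decorrelation k x : 0 <= x <= 1 ->
  iter k decorrelation x = 1 - iter k s (1 - x) /\ 0 <= iter k s (1 - x) <= 1.
Proof.
move=> x01; elim: k => [|k [IH1 IH2]] /=; first by split; [lra|apply/andP; lra].
split; last exact: s_itv.
rewrite IH1 /decorrelation clamp_id ?subKr//.
by apply/andP; lra.
Qed.

Lemma zeta_gt1 : 1 < zeta.
Proof.
have [i ni ai] := heavy; rewrite -subr_gt0 -sum_a -sumrB (bigD1 i)//=.
apply: ltr_wpDr.
  apply: sumr_ge0 => j _; rewrite -{2}(mul1r (a j)) -mulrBl.
  case: (posnP (n j)) => [/a_card0->|nj]; first by rewrite mulr0.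
  by rewrite mulr_ge0// subr_ge0 ler1n.
by rewrite -{2}(mul1r (a i)) -mulrBl mulr_gt0// subr_gt0 ltr1n.
Qed.

End PowerMixture.

(** * Increasing bijections in order topologies *)

Section MonotoneHomeo.
Context d1 d2 (S : orderTopologicalType d1) (T : orderTopologicalType d2).

(** An increasing function onto an order-convex set has no jump: a bound l of a
    neighbourhood of f x either bounds all values of f strictly, or is itself a
    value f u, and then u bounds a neighbourhood of x. *)
Lemma increasing_onto_continuous (A : set S) (B : set T) (f : S -> T) :
  {in A &, forall x y, (x < y)%O -> (f x < f y)%O} ->
  (forall x, A x -> B (f x)) ->
  (forall y, B y -> exists2 x, A x & f x = y) ->
  (forall x y z, B x -> B y -> (x <= z <= y)%O -> B z) ->
  {within A, continuous f}.
Proof.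
move=> f_lt fAB f_onto B_itv; apply/subspace_continuousP => x Ax U.
have f_refl u v : A u -> A v -> (f u < f v)%O -> (u < v)%O.
  move=> Au Av fuv; rewrite ltNge le_eqVlt; apply/negP => /orP[/eqP vu|vu].
    by rewrite vu ltxx in fuv.
  by have := lt_trans fuv (f_lt _ _ (mem_set Av) (mem_set Au) vu); rewrite ltxx.
move=> Ufx; have : nbhs (f x) U by []; rewrite itv_nbhsE => -[i [oi fxi] iU].
suff : \forall y \near x, A y -> f y \in i.
  move=> H; rewrite /nbhs/= /within/=.
  by near=> y => Ay; apply: iU; rewrite /=; move: Ay; near: y.
have lower l : (l < f x)%O -> \forall y \near x, A y -> (l < f y)%O.
  move=> lfx; have [[y0 Ay0 y0l]|nol] := pselect (exists2 y, A y & (f y <= l)%O); last first.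
    by apply: nearW => y Ay; rewrite ltNge; apply/negP => yl; apply: nol; exists y.
  have [u Au ful] : exists2 u, A u & f u = l.
    by apply: f_onto; apply: (B_itv _ _ _ (fAB _ Ay0) (fAB _ Ax)); rewrite y0l ltW.
  have ux : (u < x)%O by apply: f_refl => //; rewrite ful.
  have := @rray_open _ S u; rewrite openE => /(_ x).
  rewrite /interior /= in_itv/= ux => /(_ isT); apply: filterS => y /=.
  by rewrite in_itv/= andbT -ful => uy Ay; apply: f_lt; rewrite ?inE.
have upper r : (f x < r)%O -> \forall y \near x, A y -> (f y < r)%O.
  move=> fxr; have [[y0 Ay0 y0r]|nor] := pselect (exists2 y, A y & (r <= f y)%O); last first.
    by apply: nearW => y Ay; rewrite ltNge; apply/negP => yr; apply: nor; exists y.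
  have [u Au fur] : exists2 u, A u & f u = r.
    by apply: f_onto; apply: (B_itv _ _ _ (fAB _ Ax) (fAB _ Ay0)); rewrite y0r ltW.
  have xu : (x < u)%O by apply: f_refl => //; rewrite fur.
  have := @lray_open _ S u; rewrite openE => /(_ x).
  rewrite /interior /= in_itv/= xu => /(_ isT); apply: filterS => y /=.
  by rewrite in_itv/= -fur => uy Ay; apply: f_lt; rewrite ?inE.
move: oi fxi {iU}; case: i => -[[]l|[]] [[]r|[]] // _; rewrite in_itv/= ?andbT.
- case/andP => /lower lx /upper rx; near=> y => Ay; rewrite in_itv/=.
  by apply/andP; split; move: Ay; near: y.
- by move/lower; apply: filterS => y H /H; rewrite in_itv/= andbT.
- by move/upper; apply: filterS => y H /H; rewrite in_itv/=.
- by move=> _; apply: nearW => y _; rewrite in_itv.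
Unshelve. all: by end_near. Qed.

End MonotoneHomeo.

(** The inverse is increasing and onto as well, so [increasing_onto_continuous]
    serves in both directions. *)
Lemma increasing_onto_homeomorphism d1 d2 (S : orderTopologicalType d1)
    (T : orderTopologicalType d2) (A : set S) (B : set T) (f : S -> T) (x0 : S) :
  {in A &, forall x y, (x < y)%O -> (f x < f y)%O} ->
  (forall x, A x -> B (f x)) ->
  (forall y, B y -> exists2 x, A x & f x = y) ->
  (forall x y z, A x -> A y -> (x <= z <= y)%O -> A z) ->
  (forall x y z, B x -> B y -> (x <= z <= y)%O -> B z) ->
  homeomorphism_on A B f.
Proof.
move=> f_lt fAB f_onto A_itv B_itv.
have f_inj x y : A x -> A y -> f x = f y -> x = y.
  move=> Ax Ay fxy; have [xy|yx|//] := ltgtP x y.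
    by have := f_lt _ _ (mem_set Ax) (mem_set Ay) xy; rewrite fxy ltxx.
  by have := f_lt _ _ (mem_set Ay) (mem_set Ax) yx; rewrite fxy ltxx.
split; [|exact: (@increasing_onto_continuous _ _ _ _ A B)|].
  split => [x|x y /set_mem Ax /set_mem Ay|y By]; [exact: fAB|exact: f_inj|].
  by have [x Ax <-] := f_onto _ By; exists x.
have /boolp.choice[h hP] : forall y, exists x, B y -> A x /\ f x = y.
  move=> y; have [/f_onto[x Ax fx]|nBy] := pselect (B y); first by exists x.
  by exists x0.
have hK x : A x -> h (f x) = x.
  by move=> Ax; have [Ah fh] := hP _ (fAB _ Ax); exact: f_inj.
exists h; split; first by move=> x /set_mem /hK.
apply: (@increasing_onto_continuous _ _ _ _ B A) => //.
- move=> y z /set_mem By /set_mem Bz yz.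
  have [Ay fy] := hP _ By; have [Az fz] := hP _ Bz.
  rewrite ltNge le_eqVlt; apply/negP => /orP[/eqP zy|zy].
    by rewrite -fy -fz zy ltxx in yz.
  have := f_lt _ _ (mem_set Az) (mem_set Ay) zy; rewrite fy fz => /(lt_trans yz).
  by rewrite ltxx.
- by move=> y /hP[].
- by move=> x Ax; exists (f x); [exact: fAB|exact: hK].
Qed.

(** * The limit theorem *)

Section Extension.
Variables (R : realType) (g : R -> R).
Hypothesis g_lt : forall x y, 0 <= x -> x < y -> g x < g y.
Hypothesis g_ge0 : forall x, 0 <= x -> 0 <= g x.
Hypothesis g_le1 : forall x, 0 <= x -> g x <= 1.
Hypothesis g_surj : forall v, 0 <= v -> v < 1 -> exists2 c, 0 <= c & g c = v.

Definition extend_infty (x : \bar R) : R := if x is r%:E then g r else 1.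

Lemma extend_infty_lt (x y : \bar R) :
  (0 <= x)%E -> (x < y)%E -> extend_infty x < extend_infty y.
Proof.
case: x => [x| |]; case: y => [y| |] //=.
  by rewrite lee_fin lte_fin; exact: g_lt.
rewrite lee_fin => x0 _; apply: (@lt_le_trans _ _ (g (x + 1))).
  by apply: g_lt => //; rewrite ltrDl.
by apply: g_le1; rewrite addr_ge0.
Qed.

Lemma extend_infty_homeomorphism :
  @homeomorphism_on (\bar R) R `[0%E, +oo%E] `[0, 1] extend_infty.
Proof.
apply: (@increasing_onto_homeomorphism _ _ (\bar R) R _ _ _ 0%E).
- move=> x y; rewrite !inE /= !in_itv /= => /andP[x0 _] _.
  exact: extend_infty_lt.
- move=> x /=; rewrite !in_itv/=; case: x => [x| |] /=.
  + by rewrite lee_fin => /andP[x0 _]; apply/andP; split; [exact: g_ge0|exact: g_le1].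
  + by move=> _; rewrite ler01 lexx.
  + by [].
- move=> v /=; rewrite in_itv/= => /andP[v0]; rewrite le_eqVlt => /orP[/eqP->|v1].
    by exists +oo%E => //=; rewrite in_itv/= lexx leey.
  have [c c0 gc] := g_surj v0 v1; exists c%:E => //=.
  by rewrite in_itv/= leey lee_fin c0.
- move=> x y z /=; rewrite !in_itv/= => /andP[x0 _] _ /andP[xz _].
  by rewrite leey (le_trans x0 xz).
- move=> x y z /=; rewrite !in_itv/= => /andP[x0 _] /andP[_ y1] /andP[xz zy].
  by rewrite (le_trans x0 xz) (le_trans zy y1).
Qed.

End Extension.

Section Assembly.
Variables (R : realType) (G1 : ograph).
Hypothesis ab : vtxa G1 != vtxb G1.
Hypothesis G1_paths : two_edge_disjoint_paths (vtxa G1) (vtxb G1).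
Variable p : R.
Hypotheses (p_gt0 : 0 < p) (p_lt1 : p < 1).

Let weightG := @weight R p (edge G1) (@crossing G1).

Lemma derive_crossing_prob : derive1 (fun q : R => crossing_prob G1 q) p =
  \sum_(S : {set edge G1}) #|S|%:R * weightG S.
Proof.
rewrite (sum_card_weight p_gt0 p_lt1 (@crossing_mono G1)) -derive_mean.
by congr (derive1 _ p); apply/funext => q; exact: crossing_probE.
Qed.

(** The two disjoint configurations are those that open the edges of one of two
    edge-disjoint paths. *)
Lemma heavy_crossing_weight :
  exists2 S : {set edge G1}, (1 < #|S|)%N & 0 < weightG S.
Proof.
have [s [t [ps pt st]]] := G1_paths.
apply: (heavy_weight p_gt0 p_lt1 (@crossing_mono G1)
  (crossing_path_edges ps) (crossing_path_edges pt)); last exact: crossing_closed.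
move=> e; rewrite !ffunE; apply/negP => /andP[es et].
by move/pred0P: st => /(_ e) /=; rewrite es et.
Qed.

End Assembly.

Unset Implicit Arguments.
Set Strict Implicit.

Theorem theorem4p1 (R : realType) (G1 : ograph)
  (G1_simple : simple_graph G1)
  (G1_connected : connected_graph G1)
  (G1_dist : (1 < gdist (vtxa G1) (vtxb G1))%N)
  (G1_paths : two_edge_disjoint_paths (vtxa G1) (vtxb G1))
  (pstar : R)
  (pstar_fix :
    unique (fun p : R => 0 < p < 1 /\ crossing_prob G1 p = p) pstar)
  (zeta : R)
  (zeta_def : zeta = derive1 (fun p : R => crossing_prob G1 p) pstar) :
  exists g : \bar R -> R,
    [/\ @homeomorphism_on (\bar R) R `[0%E, +oo%E] `[0, 1] g,
        {in `[0%E, +oo%E] &, {homo g : x y / (x <= y)%E >-> x <= y}} &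
        forall (d : nat -> measure_display)
          (T : forall k, measurableType (d k))
          (P : forall k, probability (T k) R)
          (U Ut U' : forall k, edge (hgraph G1 k) -> {RV (P k) >-> R}),
        (forall k, iid_uniform (noise_family (U k) (Ut k) (U' k))) ->
        forall (eps : nat -> R) (c : \bar R),
        (forall k, 0 <= eps k <= 1) ->
        (0 <= c)%E ->
        (zeta ^+ k * eps k)%:E @[k --> \oo] --> c ->
        ('E_(P k)[fun t => ((crossing (omega (U k) pstar t))%:R *
            (crossing (omega_noise (U k) (Ut k) (U' k) pstar (eps k) t))%:R)%R])%E
          @[k --> \oo]
          --> (pstar ^+ 2 * g c + pstar * (1 - g c))%:E].
Proof.
have [[/andP[p0 p1] fix_p] _] := pstar_fix.
have ab : vtxa G1 != vtxb G1.
  by apply: contraTneq G1_dist => ->; rewrite gdist_refl.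
pose a := @weight R pstar (edge G1) (@crossing G1).
pose n := fun S : {set edge G1} => #|S|.
have a_ge0 S : 0 <= a S by exact: weight_ge0.
have a_card0 S : n S = 0%N -> a S = 0 by exact: weight_card0.
have sum_a : \sum_S a S = 1.
  by apply: sum_weight => //; rewrite -[RHS]fix_p crossing_probE.
have heavy : exists2 S, (1 < n S)%N & 0 < a S by exact: heavy_crossing_weight.
have zetaE : zeta = \sum_S (n S)%:R * a S by rewrite zeta_def derive_crossing_prob.
pose F := decorrelation a n.
pose M := \sum_S (n S)%:R ^+ 2 * a S.
have zeta1 : 1 < zeta by rewrite zetaE; exact: zeta_gt1.
have zeta0 : 0 < zeta := lt_trans ltr01 zeta1.
have M0 : 0 < M.
  apply: (lt_le_trans zeta0); rewrite zetaE; apply: ler_sum => S _.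
  rewrite ler_wpM2r// -natrX ler_nat; case: (n S) => // m; exact: leq_pmull.
have F0 : F 0 = 0 by exact: decorrelation0.
have F_lip x y : x <= y -> 0 <= F y - F x <= zeta * (y - x).
  by rewrite zetaE; exact: decorrelation_lip.
have F_le1 x : F x <= 1 by exact: decorrelation_le1.
have F_lower x : 0 <= x -> zeta * x - M * x ^+ 2 <= F x.
  by rewrite zetaE; exact: decorrelation_lower.
have F_gt x : 0 < x < 1 -> x < F x by exact: decorrelation_gt.
have F_inj x y : 0 <= x -> x < y -> y <= 1 -> F x < F y.
  by exact: decorrelation_inj.
pose g := koenigs zeta F.
have g_lt x y : 0 <= x -> x < y -> g x < g y by exact: (@koenigs_lt _ _ M).
exists (extend_infty g); split.
- apply: extend_infty_homeomorphism => //.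
  + by move=> x; exact: (@koenigs_ge0 _ _ F).
  + by move=> x; exact: (@koenigs_le1 _ _ F).
  + by move=> v; exact: (@koenigs_surj _ _ M F).
- move=> x y; rewrite !in_itv/= => /andP[x0 _] _.
  rewrite le_eqVlt => /orP[/eqP->|xy]; first exact: lexx.
  apply/ltW/extend_infty_lt => //.
  by move=> z; exact: (@koenigs_le1 _ _ F).
move=> d T P U Ut U' iid eps c eps01 c0 cvg_c.
(* As F has multiplier zeta, starting from eps k amounts to evaluating the k-th
   approximation of [g] at zeta^k * eps k. *)
pose X k := scaled_iter zeta F k (zeta ^+ k * eps k).
have XE k : X k = iter k F (eps k).
  by rewrite /X /scaled_iter mulrAC mulfV ?mul1r// expf_neq0// gt_eqF.
suff Xc : X @ \oo --> extend_infty g c.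
  rewrite (_ : (fun k => _) = fun k => (pstar ^+ 2 * X k + pstar * (1 - X k))%:E).
    apply: cvg_EFin; first exact: nearW.
    rewrite /comp /=; apply: cvgD; apply: cvgM; try exact: cvg_cst; first by [].
    by apply: cvgB => //; exact: cvg_cst.
  apply/funext => k; rewrite expectation_crossings//; congr EFin.
  have [XkE _] := iter_decorrelation a_ge0 a_card0 sum_a k (eps01 k).
  rewrite XE XkE -/(noise_step _ _) /kern /=.
  ring.
have X1 k : X k <= 1.
  by rewrite XE; apply: iter_le1 => //; have /andP[] := eps01 k.
have e0 k : 0 <= zeta ^+ k * eps k.
  by have /andP[? _] := eps01 k; rewrite mulr_ge0// exprn_ge0// ltW.
case: c c0 cvg_c => [r| |] //= r0 cvg_c.
  apply: (scaled_iter_cvg_fin) => //.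
  exact: fine_cvg cvg_c.
apply: (scaled_iter_cvg_infty (M := M)) => // A.
by move/cvgeyPge : cvg_c => /(_ A); apply: filterS => k; rewrite lee_fin.
Qed.
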